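(* Let $d\in\mathbb{X}$, $B\in\mathbb{S}^n$, let $\mathcal{B}:\mathbb{X}\to\mathbb{S}^n$ be linear, and let $x^*$ be an optimal solution of the linear SDP $$\min_{x\in\mathbb{X}}\{\langle d,x\rangle:\ \mathcal{B}x-B\in\mathbb{S}^n_+\}.$$ Suppose that the multifunction $\mathcal{H}(x):=\mathcal{B}x-B-\mathbb{S}^n_+$, $x\in\mathbb{X}$, is metrically regular at $(x^*,0)$. Pick any $S^*\in\mathcal{M}(x^*,-d)$. Let $X^*=\mathcal{B}x^*-B$, let $\alpha^*,\beta^*,\gamma^*$, $\alpha_1,\ldots,\alpha_p$ be the index sets associated with $(X,S)=(X^*,S^* )$, and let $K^*:=\mathcal{T}_{\mathbb{S}^n_+}(X^* )\cap\mathrm{Sp}(\mathcal{N}_{\mathbb{S}^n_+}(-S^* ))$. Then: (i) If $S^*\in\arg\min_{S\in\mathcal{M}(x^*,-d)}\operatorname{rank}(S)$ and $[\![d]\!]^\perp\cap\Upsilon^*=\{0\}$, then $x^*$ is tilt-stable. If $K^*\subset\mathcal{B}\mathbb{X}$, $\mathcal{B}$ is injective on $\mathcal{B}^{-1}(K^* )$ and $\operatorname{Ker}\mathcal{B}^*\cap\mathrm{Sp}(\mathcal{N}_{\mathbb{S}^n_+}(X^* ))=\{0\}$, then the tilt stability of $x^*$ implies $[\![d]\!]^\perp\cap\widetilde\Upsilon^*=\{0\}$. (ii) If $\mathcal{M}(x^*,-d)=\{S^*\}$ and $\widehat\Upsilon^*=\{0\}$, then $x^*$ is tilt-stable. If $K^*\subset\mathcal{B}\mathbb{X}$,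 $\mathcal{B}$ is injective on $\mathcal{B}^{-1}(K^* )$ and $\operatorname{Ker}\mathcal{B}^*\cap\mathrm{Sp}(\mathcal{N}_{\mathbb{S}^n_+}(X^* ))=\{0\}$, then the tilt stability of $x^*$ implies $\widehat\Upsilon^*=\{0\}$. Here - $\Upsilon^*$ is the set of $w\in\mathbb{X}$ for which there exist $P^*\in\mathbb{O}(X^* )\cap\mathbb{O}(S^* )$ and $Q=\mathrm{BlkDiag}(Q_1,\ldots,Q_p)$ with $Q_j\in\mathbb{O}^{|\alpha_j|}$ such that $R:=P^*Q\in\mathbb{O}(X^* )$ and $[R_{\alpha^*}\ R_{\beta^*}\ R_{\gamma^*}]^\top(\mathcal{B}w)R_{\gamma^*}=0$; - $\widetilde\Upsilon^*$ is the set of $w\in\mathbb{X}$ for which there exists $P^*\in\mathbb{O}(X^* )\cap\mathbb{O}(S^* )$ with $[P^*_{\alpha^*}\ P^*_{\beta^*}\ P^*_{\gamma^*}]^\top(\mathcal{B}w)P^*_{\gamma^*}=0$; - $\widehat\Upsilon^*$ is the set of $w\in\mathbb{X}$ for which there exists $R\in\mathbb{O}(X^* )\cap\mathbb{O}(S^* )$ with $[R_{\alpha^*}\ R_{\beta^*}\ R_{\gamma^*}]^\top(\mathcal{B}w)R_{\gamma^*}=0$.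
   Context: $\mathbb{X}$ is a finite-dimensional real Euclidean space; $\mathbb{S}^n$ is the space of real symmetric $n\times n$ matrices with the trace inner product and Frobenius norm; $\mathbb{S}^n_+$ is the cone of positive semidefinite matrices; $\mathbb{O}^k$ is the set of $k\times k$ real orthogonal matrices; $[n]=\{1,\ldots,n\}$; $\mathbb{B}(x,\delta)$ is the closed ball; $[\![d]\!]^\perp$ is the orthogonal complement of the span of $d$; $\mathcal{B}^*$ is the adjoint of $\mathcal{B}$. $\Gamma:=\{x\in\mathbb{X}:\mathcal{B}x-B\in\mathbb{S}^n_+\}$. Tilt stability: for $f:\mathbb{X}\to(-\infty,\infty]$ proper, $\bar x\in\mathrm{dom}\,f$ is a tilt-stable local minimum of $f$ if there is $\delta>0$ such that $M_\delta(v):=\arg\min_{x\in\mathbb{B}(\bar x,\delta)}\{f(x)-f(\bar x)-\langle v,x-\bar x\rangle\}$ is single-valued and Lipschitz continuous on some neighborhood of $v=0$ with $M_\delta(0)=\{\bar x\}$. ''$x^*$ is tilt-stable'' means that $x^*$ is a tilt-stable local minimum of $x\mapsto\langle d,x\rangle+\delta_\Gamma(x)$, $\delta_\Gamma$ the indicator function of $\Gamma$. Metric regularity: a multifunction $\mathcal{F}$ is metrically regular at $(x,z)\in\mathrm{gph}\,\mathcal{F}$ if there are $\delta,\kappa>0$ with $\mathrm{dist}(x',\mathcal{F}^{-1}(z'))\le\kappa\,\mathrm{dist}(z',\mathcal{F}(x'))$ for all $(x',z')\in\mathbb{B}((x,z),\delta)$. $\mathcal{T}_\Omega$ and $\mathcal{N}_\Omega$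 are the tangent and normal cones of convex analysis ($\mathcal{N}_\Omega(x)=\{v:\langle v,x'-x\rangle\le0\ \forall x'\in\Omega\}$). For a closed convex cone $K$, $\mathrm{Sp}(K):=\mathbb{R}_+(K-K)$ is the linear space generated by $K$. Multipliers (there is no equality constraint): $\mathcal{M}(x,v):=\{S\in\mathcal{N}_{\mathbb{S}^n_+}(\mathcal{B}x-B):\mathcal{B}^*S=v\}$ if $v\in\mathcal{N}_\Gamma(x)$, and $\emptyset$ otherwise. Spectral notation: $\lambda_1(X)\ge\cdots\ge\lambda_n(X)$ are the eigenvalues of $X\in\mathbb{S}^n$, $\lambda(X)=(\lambda_1(X),\ldots,\lambda_n(X))^\top$, $\mathbb{O}(X):=\{P\in\mathbb{O}^n: X=P\,\mathrm{Diag}(\lambda(X))P^\top\}$. For $X\in\mathbb{S}^n_+$, $S\in\mathcal{N}_{\mathbb{S}^n_+}(X)$, the distinct eigenvalues of $X$ are denoted $\mu_1>\cdots>\mu_p=0$ (the class for $\mu_p=0$ being empty if $X$ is nonsingular), and $\alpha_j:=\{i\in[n]:\lambda_i(X)=\mu_j\}$; $\alpha:=\{i:\lambda_i(X)>0\}$, $\beta:=\{i:\lambda_i(X)=0=\lambda_i(S)\}$, $\gamma:=\{i:\lambda_i(S)<0\}$; $\alpha^*,\beta^*,\gamma^*$ are these sets for $(X^*,S^* )$. $M_J$ is the submatrix of the columns of $M$ indexed by $J$. *)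

(* Defs.v *)
From HB Require Import structures.
From mathcomp Require Import all_boot all_order all_algebra.
From mathcomp Require Import all_classical all_reals ereal.
From mathcomp.real_closed Require Import polyrcf.

Set Implicit Arguments.
Unset Strict Implicit.
Unset Printing Implicit Defensive.

Import Order.TTheory GRing.Theory Num.Theory.

Local Open Scope classical_set_scope.
Local Open Scope ring_scope.

(* A Euclidean space is an lmodType (a vectType when finite dimension
   matters) together with a positive definite symmetric bilinear form
   dot : {dot V for idfun}. *)

Section Euclidean.
Variables (R : realType) (V : lmodType R) (dot : {dot V for idfun}).
Implicit Types (x v h : V) (A K Omega : set V).

Definition enorm v : R := Num.sqrt (dot v v).

Definition eball x (delta : R) : set V := [set y | enorm (y - x) <= delta].

(* Extended real, so that the distance to the empty set is +oo. *)
Definition set_dist x A : \bar R := ereal_inf [set (enorm (x - a))%:E | a in A].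

Definition normal_cone Omega x : set V :=
  [set v | Omega x /\ forall x', Omega x' -> dot v (x' - x) <= 0].

(* The closure of the cone generated by Omega - x. *)
Definition tangent_cone Omega x : set V :=
  [set h | Omega x /\ forall eps : R, 0 < eps ->
     exists t : R, exists2 y, Omega y & 0 <= t /\
       enorm (h - t *: (y - x)) < eps].

Definition Sp K : set V :=
  [set v | exists t : R, exists a b,
     [/\ 0 <= t, K a, K b & v = t *: (a - b)]].

Definition indicator_fun Omega x : \bar R := if x \in Omega then 0%E else +oo%E.

Definition proper_fun (f : V -> \bar R) : Prop :=
  (forall x, f x != -oo%E) /\ exists x, f x != +oo%E.

Definition tilted_argmin (f : V -> \bar R) (xbar : V) (delta : R) (v : V) : set V :=
  let g x := (f x - f xbar - (dot v (x - xbar))%:E)%E in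
  [set x | eball xbar delta x /\ forall y, eball xbar delta y -> (g x <= g y)%E].

Definition tilt_stable (f : V -> \bar R) (xbar : V) : Prop :=
  [/\ proper_fun f, f xbar != +oo%E &
    exists2 delta : R, 0 < delta &
      tilted_argmin f xbar delta 0 = [set xbar] /\
      exists (rho L : R) (m : V -> V),
        [/\ 0 < rho,
            forall v, eball 0 rho v -> tilted_argmin f xbar delta v = [set m v] &
            forall u v, eball 0 rho u -> eball 0 rho v ->
              enorm (m u - m v) <= L * enorm (u - v)]].

End Euclidean.

Section TwoSpaces.
Variables (R : realType) (U V : lmodType R).
Variables (dotU : {dot U for idfun}) (dotV : {dot V for idfun}).

(* A multifunction from U to V is a map U -> set V. *)
Definition metrically_regular (F : U -> set V) (x : U) (z : V) : Prop :=
  F x z /\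
  exists delta kappa : R, [/\ 0 < delta, 0 < kappa &
    forall x' z',
      enorm dotU (x' - x) ^+ 2 + enorm dotV (z' - z) ^+ 2 <= delta ^+ 2 ->
      (set_dist dotU x' [set u | F u z'] <= kappa%:E * set_dist dotV z' (F x'))%E].

Definition adjoint (A : U -> V) (v : V) : U :=
  xget 0 [set u | forall x, dotU u x = dotV v (A x)].

End TwoSpaces.

Lemma riesz (R : realType) (U : vectType R) (dotU : {dot U for idfun})
    (phi : {scalar U}) :
  exists u, forall x, dotU u x = phi x.
Proof.
pose b := vbasis {:U}.
pose G : 'M[R]_(\dim {:U}) := \matrix_(i, j) dotU b`_i b`_j.
have dotE (c : 'rV[R]_(\dim {:U})) x :
    dotU (\sum_i c 0 i *: b`_i) x = \sum_i c 0 i * dotU b`_i x.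
  by rewrite linear_sumlz; apply: eq_bigr => i _; rewrite linearZl_LR.
have Gunit : G \in unitmx.
  rewrite -row_free_unit -kermx_eq0; apply/rowV0P => c /sub_kermxP cG0.
  pose u := \sum_i c 0 i *: b`_i.
  have u0 : u = 0.
    apply/eqP; apply: contraT => /(neq0_dnorm_gt0 (s := dotU)).
    rewrite {2}/u linear_sumr /= big1 ?ltxx // => i _.
    rewrite linearZr_LR /= dotE; have /(congr1 (fun M : 'rV_ _ => M 0 i)) := cG0.
    rewrite !mxE => e.
    have -> : \sum_j c 0 j * dotU b`_j b`_i = 0.
      by rewrite -[RHS]e; apply: eq_bigr => j _; rewrite mxE.
    by rewrite mulr0.
  apply/rowP => i; rewrite mxE.
  have /freeP bfree := basis_free (vbasisP {:U}).
  by apply: (bfree (fun i => c 0 i)).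
pose f : 'rV[R]_(\dim {:U}) := \row_i phi b`_i.
pose c := f *m invmx G.
exists (\sum_i c 0 i *: b`_i) => x.
rewrite (coord_vbasis (memvf x)) !linear_sum /=; apply: eq_bigr => j _.
rewrite linearZr_LR linearZ /= dotE; congr (_ * _).
have cG : c *m G = f by rewrite /c mulmxKV.
have -> : phi b`_j = (c *m G) 0 j by rewrite cG mxE.
by rewrite mxE; apply: eq_bigr => i _; rewrite [G i j]mxE.
Qed.

Lemma adjointP (R : realType) (U : vectType R) (V : lmodType R)
    (dotU : {dot U for idfun}) (dotV : {dot V for idfun})
    (A : {linear U -> V}) v x :
  dotU (adjoint dotU dotV A v) x = dotV v (A x).
Proof.
move: x; have [u uP] := riesz dotU (dotV v \o A).
exact: (@xgetPex _ 0 [set u | forall x, dotU u x = dotV v (A x)] (ex_intro _ u uP)).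
Qed.

(* The space of real symmetric matrices. *)

Definition symsp (R : realType) (n : nat) : {vspace 'M[R]_n} :=
  lker (linfun (trmx \- idfun)).

Notation symmx R n := (subvs_of (symsp R n)).

Lemma mem_symsp (R : realType) n (A : 'M[R]_n) : (A \in symsp R n) = (A^T == A).
Proof. by rewrite memv_ker lfunE /= subr_eq0. Qed.

Section Frobenius.
Variables (R : realType) (n : nat).

Lemma symmx_tr (A : symmx R n) : (vsval A)^T = vsval A.
Proof. by apply/eqP; rewrite -mem_symsp subvsP. Qed.

Definition frob (A B : symmx R n) : R := \tr (vsval A *m vsval B).

Let frob_bilinear : bilinear_for *%R (idfun \; *%R) frob.
Proof.
split=> [B a A A'|A a B B']; rewrite /frob /=.
  by rewrite mulmxDl -scalemxAl linearP.
by rewrite mulmxDr -scalemxAr linearP.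
Qed.

HB.instance Definition _ :=
  bilinear_isBilinear.Build R (symmx R n) (symmx R n) R *%R (idfun \; *%R) frob
    frob_bilinear.

Let frobC A B : frob A B = (-1) ^+ false * idfun (frob B A).
Proof. by rewrite expr0 mul1r /frob mxtrace_mulC. Qed.

HB.instance Definition _ :=
  isHermitianSesquilinear.Build R (symmx R n) false idfun frob frobC.

Let frob_gt0 A : A != 0 -> 0 < frob A A.
Proof.
move=> A0; have fE : frob A A = \sum_i \sum_j vsval A i j ^+ 2.
  rewrite /frob -{1}symmx_tr /mxtrace exchange_big /=; apply: eq_bigr => i _.
  by rewrite mxE; apply: eq_bigr => j _; rewrite mxE expr2.
have ge0 i : 0 <= \sum_j vsval A i j ^+ 2 by apply: sumr_ge0 => j _; exact: sqr_ge0.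
rewrite lt_neqAle eq_sym fE sumr_ge0 // andbT.
apply: contra A0 => /eqP /psumr_eq0P h; apply/eqP/val_inj/matrixP => i j.
have /psumr_eq0P := h (fun i _ => ge0 i) i isT.
move=> /(_ (fun j _ => sqr_ge0 _) j isT) /eqP.
by rewrite sqrf_eq0 => /eqP -> /=; rewrite mxE.
Qed.

HB.instance Definition _ := isDotProduct.Build R (symmx R n) frob frob_gt0.

Definition psd : set (symmx R n) :=
  [set A | forall x : 'cV[R]_n, 0 <= (x^T *m vsval A *m x) 0 0].

End Frobenius.

Arguments frob {R n}.
Arguments psd {R n}.

Section Spectral.
Variables (R : realType) (n : nat).
Implicit Types (X S : symmx R n) (P Q M : 'M[R]_n).

(* rootsR lists the distinct roots increasingly; each one is repeated
   according to its multiplicity in the characteristic polynomial. *)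
Definition eigvals X : seq R :=
  let p := char_poly (vsval X) in
  rev (flatten [seq nseq (mup x p) x | x <- rootsR p]).

Definition lambda X : 'rV[R]_n := \row_i (eigvals X)`_i.

Definition orthmx k (P : 'M[R]_k) : Prop := P^T *m P = 1%:M.

Definition diagonalizers X : set 'M[R]_n :=
  [set P | orthmx P /\ vsval X = P *m diag_mx (lambda X) *m P^T].

(* The distinct eigenvalues, with 0 appended when it is not one of them;
   decreasing when X is positive semidefinite. *)
Definition deigvals X : seq R :=
  let s := undup (eigvals X) in if 0 \in s then s else rcons s 0.

Definition alpha_class X (j : 'I_(size (deigvals X))) : {set 'I_n} :=
  [set i | lambda X 0 i == (deigvals X)`_j]%SET.
Arguments alpha_class : clear implicits.

Definition alpha_set X : {set 'I_n} := [set i | 0 < lambda X 0 i]%SET.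
Definition beta_set X S : {set 'I_n} :=
  [set i | lambda X 0 i == 0 & lambda S 0 i == 0]%SET.
Definition gamma_set S : {set 'I_n} := [set i | lambda S 0 i < 0]%SET.

Definition cols M (J : {set 'I_n}) : 'M[R]_(n, #|J|) :=
  colsub (fun k : 'I_#|J| => enum_val k) M.

(* The block Qs j sits on the rows and columns indexed by alpha_class j: the
   columns of cols 1%:M J are the unit vectors indexed by J. *)
Definition BlkDiag X (Qs : forall j, 'M[R]_#|alpha_class X j|) : 'M[R]_n :=
  \sum_j cols 1%:M (alpha_class X j) *m Qs j *m (cols 1%:M (alpha_class X j))^T.

Definition annihilates X S M (W : symmx R n) : Prop :=
  (row_mx (row_mx (cols M (alpha_set X)) (cols M (beta_set X S))) (cols M (gamma_set S)))^T
    *m vsval W *m cols M (gamma_set S) = 0.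

End Spectral.

Arguments alpha_class {R n}.

Section LinearSDP.
Variables (R : realType) (E : vectType R) (dot : {dot E for idfun}) (n : nat).
Variables (calB : {linear E -> symmx R n}) (B : symmx R n).

Definition feasible : set E := [set x | psd (calB x - B)].

Definition sdp_objective (d : E) (x : E) : \bar R :=
  ((dot d x)%:E + indicator_fun feasible x)%E.

Definition optimal_solution (d : E) : set E :=
  [set x | feasible x /\ forall y, feasible y -> dot d x <= dot d y].

Definition constraint_map (x : E) : set (symmx R n) :=
  [set calB x - B - Y | Y in psd].

Definition multipliers (x v : E) : set (symmx R n) :=
  [set S | [/\ normal_cone dot feasible x v,
               normal_cone frob psd (calB x - B) S &
               adjoint dot frob calB S = v]].

Definition Upsilon (X S : symmx R n) : set E :=
  [set w | exists P : 'M[R]_n, exists Qs : forall j, 'M[R]_#|alpha_class X j|,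
     [/\ diagonalizers X P /\ diagonalizers S P,
         forall j, orthmx (Qs j),
         diagonalizers X (P *m BlkDiag Qs) &
         annihilates X S (P *m BlkDiag Qs) (calB w)]].

Definition Upsilon_tilde (X S : symmx R n) : set E :=
  [set w | exists P : 'M[R]_n,
     [/\ diagonalizers X P, diagonalizers S P & annihilates X S P (calB w)]].

Definition Upsilon_hat (X S : symmx R n) : set E :=
  [set w | exists Rm : 'M[R]_n,
     [/\ diagonalizers X Rm, diagonalizers S Rm & annihilates X S Rm (calB w)]].

End LinearSDP.

(* Main.v *)
Require Import Defs.
From HB Require Import structures.
From mathcomp Require Import all_boot all_order all_algebra.
From mathcomp Require Import all_classical all_reals ereal.
From mathcomp Require Import topology normedtype sequences.
From mathcomp Require Import ring lra.
From mathcomp.real_closed Require Import polyrcf.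
Import Order.TTheory GRing.Theory Num.Theory.
Import numFieldNormedType.Exports.

Set Implicit Arguments.
Unset Strict Implicit.
Unset Printing Implicit Defensive.

Local Open Scope classical_set_scope.
Local Open Scope ring_scope.

(** Write [G u = calB u - B], so that the constraint is [G u] psd, and [T = - S]
    for a multiplier [S]: [T] is psd, [<T, G u> = 0] and [<c, x> = <T, calB x>].

    Critical directions.  For complementary [X], [S] the columns of
    [R_alpha, R_beta, R_gamma] exhaust an orthogonal basis and [R_gamma] spans the
    range of [S], so [w] lies in Upsilon_tilde, or in Upsilon_hat, exactly when
    [calB w *m S = 0], whichever diagonalizer is taken ([mem_Upsilon_tilde]); such
    a [w] is automatically orthogonal to [d].  If [S'] is another multiplier with
    rank at least that of [S], then, eigenvalues being listed decreasingly, the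
    negative indices of [S] are among those of [S']; a common diagonalizer of [X]
    and [S'] is one of [X] and [S] times a block diagonal matrix, so
    [calB w *m S' = 0] puts [w] in Upsilon ([kernel_sub_Upsilon]).  Hence both
    sufficient conditions imply one statement: [calB w *m S = 0] forces [w = 0],
    for every multiplier [S] at the solution.

    Sufficiency.  That statement gives a uniform quadratic growth
    [<c, x - u> >= kappa |x - u|^2] for [x], [u] feasible near the solution, [c]
    near [d] and [u] admitting a multiplier for [c] ([uniform_quadratic_growth]).
    Otherwise there are violating [u_k], [x_k], [c_k], [T_k]; metric regularity
    supplies a Slater point, which bounds [T_k], and in the limit [T_k] tends to a
    multiplier [T] and [(x_k - u_k) / |x_k - u_k|] to a unit vector [w].  Since
    [<T_k, G x_k> = <c_k, x_k - u_k> = o(|x_k - u_k|^2)] and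
    [|G x_k T_k|^2 <= tr (G x_k) tr (T_k) <T_k, G x_k>] ([psd_mul_le]), while
    [G u_k T_k = 0], one gets [calB w *m T = 0], a contradiction.  The growth bound
    at the minimizer of each slightly tilted problem, where the Slater point
    guarantees a multiplier ([multiplier_exists]), keeps this minimizer inside the
    ball and makes it unique and Lipschitz in the tilt ([tilt_stable_of_critical]).

    Necessity.  The projection onto the kernel of [S] lies in the cone [K], hence
    equals [calB a] for some [a]; moving from the solution along [a] stays feasible
    and keeps the objective, so uniqueness of the minimizer gives [a = 0].  Thus
    [S] is invertible, [calB w *m S = 0] gives [calB w = 0], and injectivity gives
    [w = 0] ([kernel_trivial_of_tilt_stable]). *)

(** * Inner products *)

Section DotTheory.
Variables (R : realType) (V : lmodType R) (dot : {dot V for idfun}).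
Implicit Types (x y z : V) (a : R).

Lemma dotC x y : dot x y = dot y x.
Proof. by rewrite hermC expr0 mul1r. Qed.

Lemma dotDr x y z : dot x (y + z) = dot x y + dot x z.
Proof. exact: linearDr. Qed.

Lemma dotBr x y z : dot x (y - z) = dot x y - dot x z.
Proof. exact: linearBr. Qed.

Lemma dotNr x y : dot x (- y) = - dot x y.
Proof. exact: linearNr. Qed.

Lemma dotZr a x y : dot x (a *: y) = a * dot x y.
Proof. exact: linearZr_LR. Qed.

Lemma dot0r x : dot x 0 = 0.
Proof. exact: linear0r. Qed.

Lemma dotDl x y z : dot (x + y) z = dot x z + dot y z.
Proof. by rewrite dotC dotDr !(dotC z). Qed.

Lemma dotBl x y z : dot (x - y) z = dot x z - dot y z.
Proof. by rewrite dotC dotBr !(dotC z). Qed.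

Lemma dotNl x y : dot (- x) y = - dot x y.
Proof. by rewrite dotC dotNr dotC. Qed.

Lemma dotZl a x y : dot (a *: x) y = a * dot x y.
Proof. by rewrite dotC dotZr dotC. Qed.

Lemma dot0l x : dot 0 x = 0.
Proof. by rewrite dotC dot0r. Qed.

Lemma dot_ge0 x : 0 <= dot x x.
Proof.
have [->|x0] := eqVneq x 0; first by rewrite dot0r.
exact/ltW/(neq0_dnorm_gt0 (s := dot)).
Qed.

Lemma dot_eq0 x : (dot x x == 0) = (x == 0).
Proof.
apply/idP/idP => [/eqP x0|/eqP->]; last by rewrite dot0r.
apply: contraT => /(neq0_dnorm_gt0 (s := dot)); first by rewrite /= x0 ltxx.
Qed.

Lemma dot_inj x y : (forall z, dot x z = dot y z) -> x = y.
Proof.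
by move=> h; apply/eqP; rewrite -subr_eq0 -dot_eq0 dotBl h subrr.
Qed.

Lemma enorm_ge0 x : 0 <= enorm dot x.
Proof. exact: sqrtr_ge0. Qed.

Lemma sqr_enorm x : enorm dot x ^+ 2 = dot x x.
Proof. by rewrite sqr_sqrtr ?dot_ge0. Qed.

Lemma enorm_eq0 x : (enorm dot x == 0) = (x == 0).
Proof. by rewrite sqrtr_eq0 -dot_eq0 eq_le dot_ge0 andbT. Qed.

Lemma enorm_le x a : 0 <= a -> (enorm dot x <= a) = (dot x x <= a ^+ 2).
Proof. by move=> a0; rewrite -sqr_enorm ler_sqr ?nnegrE ?enorm_ge0. Qed.

Lemma enormB x y : enorm dot (x - y) = enorm dot (y - x).
Proof. by rewrite -opprB /enorm hnormN. Qed.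

Lemma enormZ a x : enorm dot (a *: x) = `|a| * enorm dot x.
Proof.
by rewrite /enorm dotZl dotZr mulrA -expr2 sqrtrM ?sqr_ge0 // sqrtr_sqr.
Qed.

Lemma enorm0 : enorm dot 0 = 0.
Proof. by apply/eqP; rewrite enorm_eq0. Qed.

Lemma cauchy_schwarz x y : `|dot x y| <= enorm dot x * enorm dot y.
Proof.
have [->|y0] := eqVneq y 0.
  by rewrite dot0r normr0 mulr_ge0 ?enorm_ge0.
have yy : 0 < dot y y by exact: (neq0_dnorm_gt0 (s := dot)).
rewrite -ler_sqr ?nnegrE ?mulr_ge0 ?enorm_ge0 //.
rewrite real_normK ?num_real // exprMn !sqr_enorm.
have := dot_ge0 (dot y y *: x - dot x y *: y).
rewrite dotBl !dotBr !dotZl !dotZr (dotC y x) => h.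
rewrite -subr_ge0 -(pmulr_rge0 _ yy); apply: le_trans h _.
by rewrite le_eqVlt; apply/orP; left; apply/eqP; ring.
Qed.

Lemma ler_enormD x y : enorm dot (x + y) <= enorm dot x + enorm dot y.
Proof.
rewrite enorm_le ?addr_ge0 ?enorm_ge0 // sqrrD !sqr_enorm dotDl !dotDr (dotC y x).
have h : dot x y <= enorm dot x * enorm dot y.
  exact: le_trans (ler_norm _) (cauchy_schwarz _ _).
rewrite -subr_ge0 [X in 0 <= X](_ : _ = (enorm dot x * enorm dot y - dot x y) *+ 2).
  by rewrite mulrn_wge0 // subr_ge0.
ring.
Qed.

End DotTheory.

(** * Limits along an ultrafilter *)

Lemma free_ultrafilter_exists :
  exists F : set_system nat, UltraFilter F /\ eventually `<=` F.
Proof. exact: ultraFilterLemma. Qed.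

(** Every bounded sequence converges along an ultrafilter, and all limits taken
    along the same one are compatible; fixing it once replaces the successive
    extraction of subsequences. *)
Definition ufilter : set_system nat := sval (cid free_ultrafilter_exists).

#[global] Instance ufilter_ultra : UltraFilter ufilter.
Proof. by rewrite /ufilter; case: cid => F []. Qed.

Lemma ufilter_oo : eventually `<=` ufilter.
Proof. by rewrite /ufilter; case: cid => F []. Qed.

Section UltraLimits.
Variable R : realType.
Implicit Types (u v : nat -> R) (l : R).

Lemma bounded_ulim u C : (forall k, `|u k| <= C) -> exists l : R, u @ ufilter --> l.
Proof.
move=> uC.
have K : ufilter (u @^-1` `[- C, C]).
  by apply: filterE => k; rewrite /= in_itv /= -ler_norml.
have [l [_ lcl]] := @segment_compact R (- C) C (u @ ufilter) _ K.
exists l => A nA.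
have [//|nU] := in_ultra_setVsetC (u @^-1` A) ufilter_ultra.
have [x [/= nAx Ax]] := lcl (~` A) A nU nA.
by [].
Qed.

Lemma ulim_unique u l l' : u @ ufilter --> l -> u @ ufilter --> l' -> l = l'.
Proof. by move=> h h'; exact: (cvg_unique _ h h'). Qed.

Lemma ulim_le u v l l' : u @ ufilter --> l -> v @ ufilter --> l' ->
  (forall k, u k <= v k) -> l <= l'.
Proof. by move=> h h' uv; apply: (ler_cvg_to h h'); exact: filterE. Qed.

Lemma ulim_cst l : (fun=> l) @ ufilter --> l.
Proof. exact: cvg_cst. Qed.

Lemma ulim_harmonic : (fun k => k.+1%:R^-1 : R) @ ufilter --> (0 : R).
Proof. by move=> A /cvg_harmonic h; apply: ufilter_oo. Qed.

Lemma ulim0 u v : (forall k, `|u k| <= v k) -> v @ ufilter --> (0 : R) ->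
  u @ ufilter --> (0 : R).
Proof.
move=> uv v0; apply: (@squeeze_cvgr _ _ _ _ (fun k => - v k) v) => //.
  by apply: filterE => k; rewrite -ler_norml.
by rewrite -oppr0; exact: cvgN.
Qed.

Lemma ulim_sum (I : finType) (f : I -> nat -> R) (l : I -> R) :
  (forall i, f i @ ufilter --> l i) ->
  (fun k => \sum_i f i k) @ ufilter --> \sum_i l i.
Proof. by move=> fl; apply: cvg_big => //; exact: add_continuous. Qed.

End UltraLimits.

Section WeakLimits.
Variables (R : realType) (V : vectType R) (dot : {dot V for idfun}).
Implicit Types (xs ys : nat -> V) (x y : V).

(** Convergence tested against all linear forms: in finite dimension it is norm
    convergence, and it makes images under linear maps immediate. *)
Definition wlim (xs : nat -> V) x : Prop := forall h, (fun k => dot h (xs k)) @ ufilter --> dot h x.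

Definition wbounded (xs : nat -> V) := forall h, exists C, forall k, `|dot h (xs k)| <= C.

Lemma dot_coordinates : exists u : 'I_(\dim {:V}) -> V,
  forall x, x = \sum_i dot (u i) x *: (vbasis {:V})`_i.
Proof.
have H i : exists u, forall x, dot u x = coord (vbasis {:V}) i x.
  exact: (riesz dot (coord (vbasis {:V}) i)).
have [u uP] := choice H; exists u => x.
by rewrite {1}(coord_vbasis (memvf x)); apply: eq_bigr => i _; rewrite uP.
Qed.

(** The limit is built from the limits of its coordinates. *)
Lemma wbounded_wlim xs : wbounded xs -> exists x, wlim xs x.
Proof.
move=> bx; have [u uP] := dot_coordinates.
have H i : exists l : R, (fun k => dot (u i) (xs k)) @ ufilter --> l.
  by have [C hC] := bx (u i); apply: bounded_ulim hC.
have [l lP] := choice H.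
exists (\sum_i l i *: (vbasis {:V})`_i) => h.
rewrite linear_sumr /=.
under eq_fun do rewrite [xs _]uP linear_sumr /=.
apply: ulim_sum => i; rewrite dotZr; under eq_fun do rewrite dotZr.
by apply: cvgM; [exact: lP|exact: cvg_cst].
Qed.

(** A weak limit passes through a product of two varying vectors because, in a
    basis, the inner product is a finite sum of products of linear forms. *)
Lemma wlim_dot xs x ys y : wlim xs x -> wlim ys y ->
  (fun k => dot (xs k) (ys k)) @ ufilter --> dot x y.
Proof.
move=> hx hy; have [u uP] := dot_coordinates.
have E a b : dot a b = \sum_(i < \dim {:V}) dot (vbasis {:V})`_i a * dot (u i) b.
  rewrite {1}[b]uP linear_sumr /=; apply: eq_bigr => i _.
  by rewrite dotZr mulrC (dotC dot a).
rewrite E; under eq_fun do rewrite E.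
by apply: ulim_sum => i; apply: cvgM; [exact: hx|exact: hy].
Qed.

Lemma wlim_cst x : wlim (fun=> x) x.
Proof. by move=> h; exact: cvg_cst. Qed.

Lemma wlimB xs x ys y : wlim xs x -> wlim ys y -> wlim (fun k => xs k - ys k) (x - y).
Proof.
move=> hx hy h; rewrite dotBr; under eq_fun do rewrite dotBr.
by apply: cvgB; [exact: hx|exact: hy].
Qed.

Lemma enorm_wbounded xs x C : (forall k, enorm dot (xs k - x) <= C) -> wbounded xs.
Proof.
move=> hC h; exists (`|dot h x| + enorm dot h * C) => k.
rewrite -[xs k](subrK x) dotDr addrC (le_trans (ler_normD _ _)) // lerD2l.
by rewrite (le_trans (cauchy_schwarz _ _ _)) // ler_wpM2l ?enorm_ge0.
Qed.

Lemma enorm_wlim xs x (e : nat -> R) : (forall k, enorm dot (xs k - x) <= e k) ->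
  e @ ufilter --> (0 : R) -> wlim xs x.
Proof.
move=> hC he h.
have H : (fun k => dot h (xs k - x)) @ ufilter --> (0 : R).
  apply: (@ulim0 _ _ (fun k => enorm dot h * e k)) => [k|].
    by rewrite (le_trans (cauchy_schwarz _ _ _)) // ler_wpM2l ?enorm_ge0.
  by rewrite -(mulr0 (enorm dot h)); apply: cvgM => //; exact: cvg_cst.
have -> : (fun k => dot h (xs k)) = (fun k => dot h (xs k - x) + dot h x).
  by apply/funext => k; rewrite -dotDr subrK.
by rewrite -[X in _ --> X]add0r; apply: cvgD => //; exact: cvg_cst.
Qed.

Lemma minimizing_sequence (A : Type) (P : A -> Prop) (f : A -> R) c :
    (exists a, P a) -> (forall a, P a -> c <= f a) ->
  exists m (a_ : nat -> A), [/\ forall k, P (a_ k), forall k, f (a_ k) <= m + k.+1%:R^-1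
    & forall a, P a -> m <= f a].
Proof.
move=> [a0 Pa0] lb; pose S := [set f a | a in P].
have iS : has_inf S.
  by split; [exists (f a0), a0|exists c => _ [a Pa <-]; exact: lb].
have H (k : nat) : exists a, P a /\ f a <= inf S + k.+1%:R^-1.
  have [_ [a Pa <-] h] := @inf_adherent _ S k.+1%:R^-1 ltac:(by rewrite invr_gt0) iS.
  by exists a; split => //; exact: ltW.
have [a_ aP] := choice H.
exists (inf S), a_; split => [k|k|a Pa]; [exact: (aP k).1|exact: (aP k).2|].
by apply: ge_inf; [exact: iS.2|exists a].
Qed.

End WeakLimits.

(** * The trace inner product on matrices *)

Section MatrixDot.
Variables (R : realType) (m n : nat).

Definition mxdot (A B : 'M[R]_(m, n)) : R := \tr (A^T *m B).

Let mxdot_bilinear : bilinear_for *%R (idfun \; *%R) mxdot.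
Proof.
split=> [B a A A'|A a B B']; rewrite /mxdot /=.
  by rewrite linearP mulmxDl -scalemxAl linearP.
by rewrite mulmxDr -scalemxAr linearP.
Qed.

HB.instance Definition _ :=
  bilinear_isBilinear.Build R 'M[R]_(m, n) 'M[R]_(m, n) R *%R (idfun \; *%R) mxdot
    mxdot_bilinear.

Let mxdot_sym A B : mxdot A B = (-1) ^+ false * idfun (mxdot B A).
Proof. by rewrite expr0 mul1r /mxdot -mxtrace_tr trmx_mul trmxK. Qed.

HB.instance Definition _ :=
  isHermitianSesquilinear.Build R 'M[R]_(m, n) false idfun mxdot mxdot_sym.

Lemma mxdot_sum A B : mxdot A B = \sum_i \sum_j A i j * B i j.
Proof.
rewrite exchange_big /=; apply: eq_bigr => j _; rewrite mxE.
by apply: eq_bigr => i _; rewrite mxE.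
Qed.

Let mxdot_gt0 A : A != 0 -> 0 < mxdot A A.
Proof.
move=> A0; have ge0 i : 0 <= \sum_j A i j * A i j.
  by apply: sumr_ge0 => j _; rewrite -expr2 sqr_ge0.
rewrite lt_neqAle eq_sym mxdot_sum sumr_ge0 // andbT.
apply: contra A0 => /eqP /psumr_eq0P h; apply/eqP/matrixP => i j.
have /psumr_eq0P := h (fun i _ => ge0 i) i isT.
move=> /(_ (fun j _ => sqr_ge0 _) j isT) /eqP.
by rewrite mulf_eq0 orbb mxE => /eqP.
Qed.

HB.instance Definition _ := isDotProduct.Build R 'M[R]_(m, n) mxdot mxdot_gt0.

End MatrixDot.

Arguments mxdot {R m n}.

Section MatrixDotTheory.
Variable R : realType.

Lemma mxdot_mulr m n p (A : 'M[R]_(m, n)) (B : 'M[R]_(n, p)) C :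
  mxdot C (A *m B) = mxdot (A^T *m C) B.
Proof. by rewrite /mxdot trmx_mul trmxK mulmxA. Qed.

Lemma mxdot_col n (x y : 'cV[R]_n) : mxdot x y = (x^T *m y) 0 0.
Proof. by rewrite /mxdot /mxtrace big_ord1. Qed.

(** Submultiplicativity of the Frobenius norm: Cauchy-Schwarz for each entry,
    summed over rows and columns. *)
Lemma mxdot_mul_le m n p (A : 'M[R]_(m, n)) (B : 'M[R]_(n, p)) :
  mxdot (A *m B) (A *m B) <= mxdot A A * mxdot B B.
Proof.
have E k (x : 'rV[R]_k) (y : 'cV[R]_k) :
    (x *m y) 0 0 * (x *m y) 0 0 <= mxdot x x * mxdot y y.
  have := cauchy_schwarz mxdot x^T y; rewrite -ler_sqr ?nnegrE ?mulr_ge0 ?enorm_ge0 //.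
  rewrite real_normK ?num_real // exprMn !sqr_enorm /= (mxdot_col x^T y) trmxK expr2.
  have -> : mxdot x^T x^T = mxdot x x by rewrite /mxdot trmxK mxtrace_mulC.
  by [].
have AE : mxdot A A = \sum_i mxdot (row i A) (row i A).
  rewrite mxdot_sum; apply: eq_bigr => i _; rewrite mxdot_sum big_ord1.
  by apply: eq_bigr => j _; rewrite !mxE.
have BE : mxdot B B = \sum_j mxdot (col j B) (col j B).
  rewrite mxdot_sum exchange_big; apply: eq_bigr => j _; rewrite mxdot_sum.
  by apply: eq_bigr => i _; rewrite big_ord1 !mxE.
rewrite mxdot_sum AE mulr_suml ler_sum // => i _; rewrite BE mulr_sumr ler_sum // => j _.
apply: le_trans (E _ (row i A) (col j B)).
have -> : (row i A *m col j B) 0 0 = (A *m B) i j.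
  by rewrite !mxE; apply: eq_bigr => k _; rewrite !mxE.
by [].
Qed.

End MatrixDotTheory.

(** * The spectral theorem *)

Section SpectralTheorem.
Variable R : realType.

(** The Rayleigh quotient attains its maximum, the unit sphere being compact; a
    maximizer will be an eigenvector for the largest eigenvalue. *)
Lemma rayleigh_max n (A : 'M[R]_n.+1) : exists v : 'cV[R]_n.+1, mxdot v v = 1 /\
  forall z : 'cV[R]_n.+1, mxdot z (A *m z) <= mxdot v (A *m v) * mxdot z z.
Proof.
pose unit_vec (v : 'cV[R]_n.+1) := mxdot v v = 1.
pose f (v : 'cV[R]_n.+1) := - mxdot v (A *m v).
have unit_ex : exists v, unit_vec v.
  exists (delta_mx 0 0); rewrite /unit_vec mxdot_col trmx_delta mul_delta_mx.
  by rewrite mxE !eqxx.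
have f_ge v : unit_vec v -> - enorm (@mxdot R n.+1 n.+1) A <= f v.
  move=> v1; rewrite lerN2 (le_trans (ler_norm _)) //.
  rewrite (le_trans (cauchy_schwarz mxdot v (A *m v))) //.
  rewrite [enorm _ v]/enorm /= v1 sqrtr1 mul1r ler_wsqrtr //=.
  by rewrite (le_trans (mxdot_mul_le _ _)) // v1 mulr1.
have [m [v_ [v1 fv m_le]]] := minimizing_sequence unit_ex f_ge.
have [v vP] : exists v, wlim (@mxdot R n.+1 1) v_ v.
  apply/wbounded_wlim/(@enorm_wbounded _ _ _ _ 0 1) => k.
  by rewrite subr0 /enorm /= v1 sqrtr1.
have AvP : wlim (@mxdot R n.+1 1) (fun k => A *m v_ k) (A *m v).
  move=> h /=; rewrite mxdot_mulr; under eq_fun do rewrite mxdot_mulr.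
  exact: vP.
have dv1 : mxdot v v = 1.
  apply: (ulim_unique (wlim_dot vP vP)) => /=.
  by under eq_fun do rewrite v1; exact: ulim_cst.
have fm : f v <= m.
  have L1 : (fun k => f (v_ k)) @ ufilter --> f v by exact: (cvgN (wlim_dot vP AvP)).
  have L2 : (fun k => m + k.+1%:R^-1) @ ufilter --> m + 0.
    by apply: cvgD; [exact: ulim_cst|exact: ulim_harmonic].
  by rewrite -[m]addr0; exact: (ulim_le L1 L2 fv).
exists v; split => // z.
have [->|z0] := eqVneq z 0.
  by rewrite mulmx0 (dot0r mxdot) mulr0.
have zz : 0 < mxdot z z by exact: (neq0_dnorm_gt0 (s := mxdot)).
pose c := (enorm (@mxdot R n.+1 1) z)^-1.
have cz : c ^+ 2 * mxdot z z = 1.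
  by rewrite exprVn sqr_enorm /= mulVf ?gt_eqF.
have /m_le : unit_vec (c *: z).
  by rewrite /unit_vec (dotZl mxdot) (dotZr mxdot) mulrA -expr2.
move=> /(le_trans fm); rewrite lerN2 -scalemxAr (dotZl mxdot) (dotZr mxdot) mulrA -expr2.
move=> h; rewrite -(ler_pM2l (_ : 0 < c ^+ 2)); last first.
  by rewrite exprn_gt0 // invr_gt0 lt_def enorm_ge0 enorm_eq0 z0.
by rewrite mulrCA cz mulr1.
Qed.

(** An isotropic vector [v] of a nonnegative form minimizes it, so the form has
    zero derivative at [v]; concretely, expand the form at [v + t *: A v]. *)
Lemma form_ge0_kernel n (A : 'M[R]_n) (v : 'cV[R]_n) : A^T = A ->
  (forall z : 'cV[R]_n, 0 <= mxdot z (A *m z)) -> mxdot v (A *m v) = 0 -> A *m v = 0.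
Proof.
move=> As A0 vA; apply/eqP; rewrite -(dot_eq0 mxdot) /=; apply/eqP.
set h := A *m v; set a := mxdot h h; set b := mxdot h (A *m h).
have a0 : 0 <= a by exact: (dot_ge0 mxdot).
have b0 : 0 <= b by exact: A0.
have H t : 0 <= t * a *+ 2 + t ^+ 2 * b.
  have := A0 (v + t *: h).
  rewrite mulmxDr -scalemxAr (dotDl mxdot) !(dotDr mxdot) !(dotZl mxdot) !(dotZr mxdot).
  rewrite /= vA -/h -/a -/b.
  have -> : mxdot v (A *m h) = a by rewrite mxdot_mulr As.
  by move=> H; apply: le_trans H _; rewrite le_eqVlt; apply/orP; left; apply/eqP; ring.
(* at this [t] the expansion is negative unless [a = 0]; the [+ 1] keeps the denominator positive *)
have := H (- a / (b + 1)).
have b1 : 0 < b + 1 by rewrite ltr_wpDl.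
have -> : - a / (b + 1) * a *+ 2 + (- a / (b + 1)) ^+ 2 * b =
   - (a ^+ 2 * ((b + 2) / (b + 1) ^+ 2)) by field; rewrite lt0r_neq0.
rewrite oppr_ge0 pmulr_lle0; last by rewrite divr_gt0 ?exprn_gt0 // ltr_wpDl.
by move=> h1; apply/eqP; rewrite -sqrf_eq0 eq_le h1 sqr_ge0.
Qed.

(** The reflection exchanging the first basis vector and [v]. *)
Lemma householder n (v : 'cV[R]_n.+1) : mxdot v v = 1 ->
  exists P : 'M[R]_n.+1, orthmx P /\ P *m delta_mx 0 0 = v.
Proof.
move=> v1; pose e : 'cV[R]_n.+1 := delta_mx 0 0; pose u := v - e.
have ee : mxdot e e = 1.
  by rewrite mxdot_col trmx_delta mul_delta_mx mxE !eqxx.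
have [u0|u0] := eqVneq u 0.
  exists 1%:M; rewrite /orthmx trmx1 !mul1mx; split=> //.
  by apply/esym/eqP; rewrite -subr_eq0; apply/eqP.
pose s := mxdot u u; have s0 : s != 0 by rewrite (dot_eq0 mxdot).
have uu : u^T *m u = s%:M by rewrite [LHS]mx11_scalar -mxdot_col.
have ue : u^T *m e = (- (s / 2))%:M.
  rewrite [LHS]mx11_scalar -mxdot_col /s /u (dotBl mxdot) (dotBl mxdot) !(dotBr mxdot) /=.
  rewrite v1 ee (dotC mxdot e v) /=; congr (_%:M).
  by field.
pose P := 1%:M - (2 / s) *: (u *m u^T).
have Pt : P^T = P by rewrite /P linearB linearZ /= trmx1 trmx_mul trmxK.
exists P; split; last first.
  rewrite mulmxBl mul1mx -scalemxAl -mulmxA ue mul_mx_scalar scalerA.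
  have -> : 2 / s * - (s / 2) = -1 by field.
  by rewrite scaleN1r opprK addrC subrK.
rewrite /orthmx Pt /P mulmxBl mul1mx mulmxBr mulmx1 -!scalemxAl -!scalemxAr.
rewrite -mulmxA (mulmxA u^T) uu mul_scalar_mx -!scalemxAr !scalerA.
have -> : 2 / s * (2 / s * s) = 2 / s + 2 / s by field.
by rewrite scalerDl opprB addrK subrK.
Qed.

(** Split off a maximizer of the Rayleigh quotient as first column and recurse on
    the orthogonal complement: every later eigenvalue is a value of the quotient,
    hence below the first, so the diagonal comes out sorted. *)
Theorem spectral_theorem n (A : 'M[R]_n) : A^T = A ->
  exists (P : 'M[R]_n) (d : 'rV[R]_n), [/\ orthmx P, A = P *m diag_mx d *m P^T &
    forall i j : 'I_n, (i <= j)%N -> d 0 j <= d 0 i].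
Proof.
elim: n A => [|n IH] A As.
  exists 1%:M, 0; rewrite /orthmx; split; last by case.
    by apply/matrixP; case.
  by apply/matrixP; case.
have [v [v1 vmax]] := rayleigh_max A; set l := mxdot v (A *m v) in vmax.
have Av : A *m v = l *: v.
  have : (l%:M - A) *m v = 0.
    apply: form_ge0_kernel => [|z|]; first by rewrite linearB /= tr_scalar_mx As.
      by rewrite mulmxBl mul_scalar_mx (dotBr mxdot) (dotZr mxdot) subr_ge0 vmax.
    by rewrite mulmxBl mul_scalar_mx (dotBr mxdot) (dotZr mxdot) /= v1 mulr1 subrr.
  by rewrite mulmxBl mul_scalar_mx => /eqP; rewrite subr_eq0 => /eqP.
have [P [PP Pe]] := householder v1.
have PPt : P *m P^T = 1%:M by exact: mulmx1C.
have [C0 C0E] : exists C0 : 'M[R]_n.+1, C0 = P^T *m A *m P by exists (P^T *m A *m P).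
have Cs0 : C0^T = C0 by rewrite C0E !trmx_mul trmxK As mulmxA.
have C0e : C0 *m (delta_mx 0 0 : 'cV_n.+1) = l *: delta_mx 0 0.
  by rewrite C0E -mulmxA Pe -mulmxA Av -scalemxAr -Pe mulmxA PP mul1mx.
have C0i i : C0 i 0 = l *+ (i == 0).
  have := congr1 (fun M : 'cV_ _ => M i 0) C0e; rewrite -colE !mxE eqxx andbT => ->.
  by rewrite mulr_natr.
have [C CC0] : exists C : 'M[R]_(1 + n), C = C0 by exists C0.
have Cs : C^T = C by rewrite CC0; exact: Cs0.
have Ci0 i : C i (lshift n 0) = l *+ (i == lshift n 0).
  have -> : lshift n 0 = 0 :> 'I_(1 + n) by apply/val_inj.
  by rewrite CC0; exact: C0i.
have CE : C = block_mx l%:M 0 0 (drsubmx C).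
  rewrite -{1}[C]submxK; congr block_mx.
  - by apply/matrixP => i j; rewrite !ord1 !mxE Ci0 eqxx.
  - apply/matrixP => i j; rewrite !ord1 -Cs !mxE Ci0.
    by case: eqP => // /(congr1 val).
  - apply/matrixP => i j; rewrite !ord1 !mxE Ci0.
    by case: eqP => // /(congr1 val).
have [Q [d [QQ dE dsorted]]] := IH (drsubmx C) ltac:(by rewrite trmx_drsub Cs).
pose D : 'rV[R]_(1 + n) := row_mx l%:M d.
pose W : 'M[R]_(1 + n) := (P : 'M[R]_(1 + n)) *m block_mx 1%:M 0 0 Q.
have WW : orthmx W.
  rewrite /orthmx /W trmx_mul mulmxA -(mulmxA _ P^T) PP mulmx1 tr_block_mx mulmx_block.
  rewrite !trmx0 trmx1 !mulmx0 !mul0mx !mulmx1 !addr0 add0r QQ.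
  by rewrite -scalar_mx_block.
have WWt : W *m W^T = 1%:M by exact: mulmx1C.
have AE : A = W *m diag_mx D *m W^T.
  have -> : W *m diag_mx D *m W^T = P *m C0 *m P^T.
    rewrite -CC0 CE dE /W trmx_mul tr_block_mx !trmx0 trmx1 diag_mx_row.
    rewrite -!mulmxA; congr (_ *m _); rewrite !mulmxA; congr (_ *m _).
    rewrite !mulmx_block !mulmx0 !mul0mx !addr0 !add0r !mulmx1 !mul1mx.
    rewrite !mul0mx; congr block_mx.
    by apply/matrixP => i j; rewrite !ord1 !mxE !eqxx.
  by rewrite C0E !mulmxA PPt mul1mx -mulmxA PPt mulmx1.
have [W1 [D1 [WW1 AE1 D1E]]] : exists (W1 : 'M[R]_n.+1) (D1 : 'rV[R]_n.+1),
    [/\ orthmx W1, A = W1 *m diag_mx D1 *m W1^T & D1 = D] by exists W, D.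
have Dle j : D1 0 j <= l.
  pose e : 'cV[R]_n.+1 := delta_mx j 0.
  have ee : mxdot e e = 1 by rewrite mxdot_col trmx_delta mul_delta_mx mxE !eqxx.
  have WTW (x : 'cV[R]_n.+1) : W1^T *m (W1 *m x) = x by rewrite mulmxA WW1 mul1mx.
  have := vmax (W1 *m e); rewrite AE1 -!mulmxA WTW.
  have WW2 (x y : 'cV[R]_n.+1) : mxdot (W1 *m x) (W1 *m y) = mxdot x y.
    by rewrite mxdot_mulr WTW.
  rewrite !WW2 ee mulr1; apply: le_trans.
  by rewrite mxdot_col mul_diag_mx trmx_delta -rowE !mxE !eqxx mulr1.
exists W1, D1; split => // i j.
have D0 : D1 0 0 = l.
  have H : D 0 (lshift n 0) = l by rewrite row_mxEl mxE eqxx.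
  by rewrite -[RHS]H D1E; congr (D 0 _); exact: val_inj.
have Dr k : D1 0 (lift 0 k) = d 0 k.
  have H : D 0 (rshift 1 k) = d 0 k by rewrite row_mxEr.
  by rewrite -[RHS]H D1E; congr (D 0 _); exact: val_inj.
case: (unliftP 0 i) => [i'|] ->; last by rewrite D0.
case: (unliftP 0 j) => [j'|] -> //.
by rewrite !lift0 !Dr ltnS; exact: dsorted.
Qed.

End SpectralTheorem.

(** * Eigenvalues read off a sorted diagonalization *)

Section Eigenvalues.
Variables (R : realType) (n : nat).

Lemma char_poly_orth (P A : 'M[R]_n) : orthmx P ->
  char_poly (P *m A *m P^T) = char_poly A.
Proof.
move=> PP; have PPt : P *m P^T = 1%:M by exact: mulmx1C.
rewrite /char_poly /char_poly_mx.
have -> : 'X%:M - map_mx polyC (P *m A *m P^T) =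
    map_mx polyC P *m ('X%:M - map_mx polyC A) *m map_mx polyC P^T.
  rewrite mulmxBr mulmxBl !map_mxM; congr (_ - _).
  by rewrite mul_mx_scalar -scalemxAl -map_mxM PPt map_mx1 scalemx1.
rewrite !det_mulmx mulrAC -det_mulmx -map_mxM PPt.
by rewrite map_mx1 det1 mul1r.
Qed.

Lemma mup_prod_XsubC (s : seq R) x :
  mup x (\prod_(y <- s) ('X - y%:P)) = count_mem x s.
Proof.
elim: s => [|y s IH]; first by rewrite big_nil mupNroot // root1.
rewrite big_cons mupM ?polyXsubC_eq0 ?monic_neq0 ?monic_prod_XsubC // IH.
by rewrite -['X - y%:P]expr1 mup_XsubCX /=; case: eqP.
Qed.

Lemma sorted_flatten_nseq (s : seq R) (m : R -> nat) :
  sorted <%R s -> sorted <=%R (flatten [seq nseq (m x) x | x <- s]).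
Proof.
rewrite le_sorted_pairwise lt_sorted_pairwise; elim: s => //= x s IH /andP[xs /IH ps].
rewrite pairwise_cat ps andbT; apply/andP; split; last first.
  by apply/(pairwiseP 0) => i j; rewrite !inE size_nseq !nth_nseq => -> -> _.
apply/allrelP => _ z /nseqP[-> _] /flattenP[_ /mapP[y ys ->]] /nseqP[-> _].
by rewrite ltW //; exact: (allP xs).
Qed.

(** A sorted diagonal form determines [lambda]: the two lists have equal
    multiplicities, read off the characteristic polynomial, and both are sorted. *)
Lemma lambda_sorted_diag (X : symmx R n) (P : 'M[R]_n) (d : 'rV[R]_n) :
  orthmx P -> vsval X = P *m diag_mx d *m P^T ->
  (forall i j : 'I_n, (i <= j)%N -> d 0 j <= d 0 i) -> lambda X = d.
Proof.
move=> PP XE dsort; pose s := [seq d 0 i | i <- enum 'I_n].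
have pE : char_poly (vsval X) = \prod_(y <- s) ('X - y%:P).
  rewrite XE char_poly_orth // char_poly_trig ?diag_mx_is_trig //.
  rewrite /s big_map big_enum /=; apply: eq_bigr => i _.
  by rewrite mxE eqxx.
have p0 : char_poly (vsval X) != 0 by rewrite pE monic_neq0 ?monic_prod_XsubC.
have sE : eigvals X = s.
  rewrite -[s]revK /eigvals; congr rev.
  apply: le_sorted_eq.
  - exact/sorted_flatten_nseq/sorted_roots.
  - rewrite rev_sorted sorted_map; apply: (@sub_sorted _ (relpre val leq)).
      by move=> i j /= /dsort.
    by have := iota_sorted 0 n; rewrite -val_enum_ord sorted_map.
  apply/allP => x _ /=; apply/eqP; rewrite count_rev -(mup_prod_XsubC s) -pE.
  rewrite count_flatten -map_comp sumnE big_map.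
  under eq_bigr do rewrite /= count_nseq.
  have [xr|xr] := boolP (x \in rootsR (char_poly (vsval X))).
    rewrite (bigD1_seq x) //= ?eqxx ?mul1n; last exact/lt_sorted_uniq/sorted_roots.
    by rewrite big1 ?addn0 // => y /negPf yx; rewrite /= yx mul0n.
  rewrite big_seq big1 => [|y yr]; last first.
    have /negPf yx : y != x by apply: contraNneq xr => <-.
    by rewrite /= yx mul0n.
  rewrite mupNroot //; apply: contra xr => xr.
  by have := roots_on_rootsR p0 x; rewrite in_itv /= xr => <-.
apply/rowP => i; rewrite mxE sE /s (nth_map i) ?size_enum_ord //.
by rewrite nth_ord_enum.
Qed.

End Eigenvalues.

(** * Positive semidefinite matrices *)

Section Psd.
Variables (R : realType) (n : nat).
Implicit Types (X Y S T W : symmx R n) (z : 'cV[R]_n).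

(** Meaningful on symmetric matrices only, see [symmatK]. *)
Definition symmat (A : 'M[R]_n) : symmx R n := vsproj (symsp R n) A.

Lemma symmatK A : A^T = A -> vsval (symmat A) = A.
Proof. by move=> As; rewrite vsprojK // mem_symsp As. Qed.

Lemma frob_mxdot X Y : frob X Y = mxdot (vsval X) (vsval Y).
Proof. by rewrite /mxdot symmx_tr. Qed.

Lemma psdP X : psd X <-> forall z, 0 <= mxdot z (vsval X *m z).
Proof. by split=> h z; have := h z; rewrite mxdot_col mulmxA. Qed.

Lemma psd0 : psd (0 : symmx R n).
Proof. by apply/psdP => z; rewrite linear0 mul0mx (dot0r mxdot). Qed.

Lemma psdD X Y : psd X -> psd Y -> psd (X + Y).
Proof.
move=> /psdP hX /psdP hY; apply/psdP => z.
by rewrite linearD /= mulmxDl (dotDr mxdot) addr_ge0 ?hX ?hY.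
Qed.

Lemma psdZ (a : R) X : 0 <= a -> psd X -> psd (a *: X).
Proof.
move=> a0 /psdP hX; apply/psdP => z.
by rewrite linearZ /= -scalemxAl (dotZr mxdot) mulr_ge0 ?hX.
Qed.

Lemma psd_gram_mx (V : 'M[R]_n) X : vsval X = V *m V^T -> psd X.
Proof.
move=> XE; apply/psdP => z; rewrite XE -mulmxA mxdot_mulr.
exact: (dot_ge0 mxdot).
Qed.

Lemma psd_diag (P : 'M[R]_n) (d : 'rV[R]_n) X : orthmx P ->
  vsval X = P *m diag_mx d *m P^T -> psd X -> forall i, 0 <= d 0 i.
Proof.
move=> PP XE /psdP hX i; have := hX (P *m delta_mx i 0).
rewrite XE -!mulmxA (mulmxA P^T) PP mul1mx mxdot_mulr mulmxA PP mul1mx.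
by rewrite mxdot_col mul_diag_mx trmx_delta -rowE !mxE !eqxx mulr1.
Qed.

Lemma diag_gram_mx (P : 'M[R]_n) (d : 'rV[R]_n) : (forall i, 0 <= d 0 i) ->
  exists V : 'M[R]_n, P *m diag_mx d *m P^T = V *m V^T.
Proof.
move=> d0; exists (P *m diag_mx (\row_i Num.sqrt (d 0 i))).
rewrite trmx_mul tr_diag_mx !mulmxA -(mulmxA P (diag_mx _) (diag_mx _)).
rewrite mulmx_diag; congr (_ *m diag_mx _ *m _); apply/rowP => i.
by rewrite !mxE -expr2 sqr_sqrtr.
Qed.

Lemma diag_psd (P : 'M[R]_n) (d : 'rV[R]_n) X :
  vsval X = P *m diag_mx d *m P^T -> (forall i, 0 <= d 0 i) -> psd X.
Proof.
move=> XE /(diag_gram_mx P)[V VE]; apply: (@psd_gram_mx V); rewrite XE; exact: VE.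
Qed.

Lemma psd_gramP X : psd X -> exists V : 'M[R]_n, vsval X = V *m V^T.
Proof.
have [P [d [PP XE _]]] := spectral_theorem (symmx_tr X).
by move=> /(psd_diag PP XE) /(diag_gram_mx P); rewrite XE.
Qed.

(** Writing psd matrices as Gram matrices turns their inner product into a squared
    norm; positivity and the complementarity estimates below follow. *)
Lemma frob_gram (V W : 'M[R]_n) X Y : vsval X = V *m V^T -> vsval Y = W *m W^T ->
  frob X Y = mxdot (V^T *m W) (V^T *m W).
Proof.
move=> XE YE; rewrite /frob /mxdot XE YE trmx_mul trmxK.
by rewrite [V *m _ *m _]mulmxA mxtrace_mulC !mulmxA.
Qed.

Lemma frob_psd_ge0 X Y : psd X -> psd Y -> 0 <= frob X Y.
Proof.
move=> /psd_gramP[V XE] /psd_gramP[W YE]; rewrite (frob_gram XE YE).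
exact: (dot_ge0 mxdot).
Qed.

Lemma mxdot_gram (V : 'M[R]_n) : mxdot V V = \tr (V *m V^T).
Proof. by rewrite /mxdot mxtrace_mulC. Qed.

Lemma mxdot_trmx (V : 'M[R]_n) : mxdot V^T V^T = \tr (V *m V^T).
Proof. by rewrite /mxdot trmxK. Qed.

(** With [X = V V^T] and [Y = W W^T], [X Y = V (V^T W) W^T] and the middle factor
    has squared norm [frob X Y].  This quantifies how a small inner product of psd
    matrices forces a small product; for inner product zero see [psd_mul_eq0]. *)
Lemma psd_mul_le X Y : psd X -> psd Y ->
  mxdot (vsval X *m vsval Y) (vsval X *m vsval Y) <=
  \tr (vsval X) * frob X Y * \tr (vsval Y).
Proof.
move=> /psd_gramP[V XE] /psd_gramP[W YE]; rewrite (frob_gram XE YE) XE YE.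
rewrite -mulmxA (mulmxA V^T) mulmxA.
apply: le_trans (mxdot_mul_le _ _) _.
rewrite mxdot_trmx ler_wpM2r //.
  by rewrite -mxdot_gram (dot_ge0 mxdot).
by rewrite -mxdot_gram mxdot_mul_le.
Qed.

Lemma psd_tr_ge0 X : psd X -> 0 <= \tr (vsval X).
Proof. by move=> /psd_gramP[V ->]; rewrite -mxdot_gram (dot_ge0 mxdot). Qed.

Lemma psd_mul_eq0 X Y : psd X -> psd Y -> frob X Y = 0 -> vsval X *m vsval Y = 0.
Proof.
move=> hX hY XY0; have := psd_mul_le hX hY; rewrite XY0 mulr0 mul0r => h.
apply/eqP; rewrite -(dot_eq0 mxdot) /= eq_le h; exact: (dot_ge0 mxdot).
Qed.

Lemma frob_le_tr X : psd X -> frob X X <= \tr (vsval X) ^+ 2.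
Proof.
move=> /psd_gramP[V XE]; rewrite frob_mxdot XE.
by rewrite (le_trans (mxdot_mul_le _ _)) // mxdot_trmx mxdot_gram expr2.
Qed.

Lemma frob_rank1 X z : frob X (symmat (z *m z^T)) = mxdot z (vsval X *m z).
Proof.
by rewrite /frob symmatK ?trmx_mul ?trmxK // mulmxA mxtrace_mulC.
Qed.

Lemma psd_rank1 z : psd (symmat (z *m z^T)).
Proof.
apply/psdP => y; rewrite symmatK ?trmx_mul ?trmxK // -mulmxA mxdot_mulr.
exact: (dot_ge0 mxdot).
Qed.

Lemma psd_dual X : (forall Y, psd Y -> 0 <= frob X Y) -> psd X.
Proof. by move=> h; apply/psdP => z; rewrite -frob_rank1 h //; exact: psd_rank1. Qed.

Lemma normal_cone_psd X S :
  normal_cone frob psd X S <-> [/\ psd X, psd (- S) & frob S X = 0].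
Proof.
split=> [[hX h]|[hX hS SX]]; last first.
  split=> // Y hY; rewrite (dotBr frob) /= SX subr0 -oppr_ge0 -(dotNl frob).
  exact: frob_psd_ge0.
have SX : frob S X = 0.
  apply/eqP; rewrite eq_le -oppr_le0 andbC.
  have := h 0 psd0; rewrite sub0r (dotNr frob) /= => -> /=.
  by have := h (X + X) (psdD hX hX); rewrite addrK.
split=> //; apply: psd_dual => Y hY; rewrite (dotNl frob) oppr_ge0.
by have := h Y hY; rewrite (dotBr frob) /= SX subr0.
Qed.

End Psd.

(** * Simultaneous diagonalization of complementary matrices *)

Section Complementary.
Variables (R : realType) (n : nat).
Implicit Types (X S W : symmx R n) (P : 'M[R]_n).

Lemma lambda_sorted X (i j : 'I_n) : (i <= j)%N -> lambda X 0 j <= lambda X 0 i.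
Proof.
have [P [d [PP XE ds]]] := spectral_theorem (symmx_tr X).
by rewrite (lambda_sorted_diag PP XE ds); exact: ds.
Qed.

(** This is the uniqueness in Moreau's decomposition: [X] and [X'] are both the
    projection of the common sum onto the psd cone. *)
Lemma psd_split_unique X S X' S' : X + S = X' + S' ->
  psd X -> psd (- S) -> psd X' -> psd (- S') ->
  frob X S = 0 -> frob X' S' = 0 -> X = X'.
Proof.
move=> E hX hS hX' hS' XS XS'; apply/eqP; rewrite -subr_eq0 -(dot_eq0 frob).
rewrite eq_le (dot_ge0 frob) andbT.
have {2}-> : X - X' = S' - S.
  by rewrite -[in LHS](addrK S X) E (addrC X') addrAC addrK.
rewrite (dotBr frob) !(dotBl frob) /= XS XS' subr0 sub0r.
rewrite opprK -oppr_ge0 opprD -!(dotNr frob).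
by rewrite addr_ge0 //; exact: frob_psd_ge0.
Qed.

(** Diagonalize [X + S]: by uniqueness of the decomposition, [X] and [S] are its
    positive and negative parts, and taking these parts of a sorted list of
    eigenvalues leaves it sorted. *)
Theorem simultaneous_diagonalizer X S : normal_cone frob psd X S ->
  exists P, diagonalizers X P /\ diagonalizers S P.
Proof.
move=> /normal_cone_psd[hX hS SX].
have [P [m [PP ME ms]]] := spectral_theorem (symmx_tr (X + S)).
pose mp : 'rV[R]_n := \row_i Num.max (m 0 i) 0.
pose mn : 'rV[R]_n := \row_i Num.min (m 0 i) 0.
pose X' := symmat (P *m diag_mx mp *m P^T).
pose S' := symmat (P *m diag_mx mn *m P^T).
have trE (d : 'rV[R]_n) : (P *m diag_mx d *m P^T)^T = P *m diag_mx d *m P^T.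
  by rewrite !trmx_mul trmxK tr_diag_mx mulmxA.
have X'E : vsval X' = P *m diag_mx mp *m P^T by rewrite symmatK.
have S'E : vsval S' = P *m diag_mx mn *m P^T by rewrite symmatK.
have hX' : psd X'.
  by apply: (diag_psd X'E) => i; rewrite mxE le_max lexx orbT.
have hS' : psd (- S').
  apply: (@diag_psd _ _ P (- mn)) => [|i].
    by rewrite !linearN /= S'E mulNmx.
  by rewrite !mxE oppr_ge0 ge_min lexx orbT.
have XS' : frob X' S' = 0.
  rewrite /frob X'E S'E -!mulmxA (mulmxA P^T) PP mul1mx (mulmxA (diag_mx mp)) mulmx_diag.
  have -> : diag_mx (\row_i (mp 0 i * mn 0 i)) = 0.
    apply/matrixP => i j; rewrite !mxE.
    by case: (leP (m 0 i) 0) => _; rewrite ?mulr0 ?mul0r mul0rn.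
  by rewrite mul0mx mulmx0 mxtrace0.
have E : X + S = X' + S'.
  apply/val_inj; rewrite -[LHS]/(vsval (X + S)) ME -[RHS]/(vsval (X' + S')).
  rewrite [RHS]linearD /= X'E S'E -mulmxDl -mulmxDr -linearD /=.
  congr (_ *m diag_mx _ *m _); apply/rowP => i; rewrite !mxE.
  by rewrite addr_max_min addr0.
have XX' : X = X'.
  by apply: (psd_split_unique E) => //; rewrite (dotC frob).
have SS' : S = S' by apply: (addrI X); rewrite {2}XX'.
exists P; split; split=> //.
  rewrite XX' X'E (lambda_sorted_diag PP X'E) // => i j /ms ij.
  by rewrite !mxE ge_max !le_max ij lexx orbT.
rewrite SS' S'E (lambda_sorted_diag PP S'E) // => i j /ms ij.
by rewrite !mxE le_min !ge_min ij lexx orbT.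
Qed.

Lemma col_mulmx p q r (A : 'M[R]_(p, q)) (B : 'M[R]_(q, r)) j :
  col j (A *m B) = A *m col j B.
Proof. by rewrite !colE mulmxA. Qed.

Lemma mul_colsP (P Y : 'M[R]_n) (J : {set 'I_n}) :
  Y *m cols P J = 0 <-> forall i, i \in J -> Y *m col i P = 0.
Proof.
split=> [h i iJ|h].
  have := congr1 (col (enum_rank_in iJ i)) h.
  rewrite col_mulmx (_ : col _ (cols P J) = col i P); last first.
    by apply/colP => k; rewrite !mxE enum_rankK_in.
  by move=> ->; apply/colP => k; rewrite !mxE.
apply/matrixP => a k; have := h (enum_val k) (enum_valP k).
move=> /(congr1 (fun M : 'cV_ _ => M a 0)); rewrite !mxE => H; rewrite -[RHS]H.
by apply: eq_bigr => l _; rewrite !mxE.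
Qed.

Lemma diag_kernelP P (d : 'rV[R]_n) (Y : 'M[R]_n) : orthmx P ->
  Y *m (P *m diag_mx d *m P^T) = 0 <-> forall i, d 0 i != 0 -> Y *m col i P = 0.
Proof.
move=> PP; have E : Y *m (P *m diag_mx d *m P^T) = 0 <-> Y *m P *m diag_mx d = 0.
  split=> h; last by rewrite !mulmxA h mul0mx.
  by have := congr1 (mulmx^~ P) h; rewrite /= -!mulmxA PP mulmx1 !mulmxA mul0mx.
rewrite E mul_mx_diag; split=> [h i di|h].
  rewrite -col_mulmx; apply/colP => a; have := congr1 (fun M : 'M_n => M a i) h.
  by rewrite !mxE => /eqP; rewrite mulf_eq0 (negPf di) orbF => /eqP.
apply/matrixP => a i; rewrite !mxE.
have [->|/h] := eqVneq (d 0 i) 0; first by rewrite mulr0.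
by rewrite -col_mulmx => /(congr1 (fun M : 'cV_n => M a 0)); rewrite !mxE => ->; rewrite mul0r.
Qed.

(** The index sets alpha, beta, gamma cover all indices as soon as [X] has
    nonnegative and [S] nonpositive eigenvalues, so the left factor in
    [annihilates] is injective and can be dropped. *)
Lemma annihilatesP X S P W :
    (forall i, 0 <= lambda X 0 i) -> (forall i, lambda S 0 i <= 0) -> orthmx P ->
  annihilates X S P W <-> forall i, lambda S 0 i != 0 -> vsval W *m col i P = 0.
Proof.
move=> X0 S0 PP; rewrite /annihilates.
have gammaE i : (i \in gamma_set S) = (lambda S 0 i != 0).
  by rewrite inE lt_neqAle S0 andbT.
have -> : (forall i, lambda S 0 i != 0 -> vsval W *m col i P = 0) <->
    vsval W *m cols P (gamma_set S) = 0.
  by rewrite mul_colsP; split=> h i; have := h i; rewrite gammaE.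
set Y := vsval W *m cols P (gamma_set S).
rewrite -mulmxA -/Y; split=> [|->]; last by rewrite mulmx0.
rewrite !tr_row_mx !mul_col_mx => /eqP; rewrite !col_mx_eq0.
move=> /andP[/andP[/eqP Ya /eqP Yb] /eqP Yc].
have covered J : (cols P J)^T *m Y = 0 -> forall i, i \in J -> Y^T *m col i P = 0.
  move=> /(congr1 trmx); rewrite trmx_mul trmxK trmx0 => h i iJ.
  have := congr1 (col (enum_rank_in iJ i)) h.
  rewrite col_mulmx (_ : col _ (cols P J) = col i P); last first.
    by apply/colP => k; rewrite !mxE enum_rankK_in.
  by move=> ->; apply/colP => k; rewrite !mxE.
have YP : Y^T *m P = 0.
  suff H i : Y^T *m col i P = 0.
    apply/matrixP => a i; have := congr1 (fun M : 'cV_ _ => M a 0) (H i).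
    by rewrite -col_mulmx !mxE.
  have [Xi|Xi] := boolP (i \in alpha_set X); first exact: (covered _ Ya i Xi).
  have [Si|Si] := boolP (i \in gamma_set S); first exact: (covered _ Yc i Si).
  apply: (covered _ Yb i); rewrite inE; apply/andP; split.
    by rewrite eq_le X0 andbT leNgt; move: Xi; rewrite inE.
  by move: Si; rewrite gammaE negbK.
rewrite -[Y]trmxK -[Y^T]mulmx1 -(mulmx1C PP) mulmxA YP mul0mx trmx0 //.
Qed.

End Complementary.

(** * The critical sets as kernels *)

Section Upsilons.
Variables (R : realType) (n : nat).
Implicit Types (X S : symmx R n) (P : 'M[R]_n).

Definition row_support (d : 'rV[R]_n) : {set 'I_n} := [set i | d 0 i != 0]%SET.

Lemma mem_row_support d i : (i \in row_support d) = (d 0 i != 0).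
Proof. by rewrite inE. Qed.

Lemma mxrank_sum_le (I : finType) (P : pred I) (A : I -> 'M[R]_n) :
  (\rank (\sum_(i | P i) A i)%R <= \sum_(i | P i) \rank (A i))%N.
Proof.
elim/big_rec2: _ => [|i r B _ IH]; first by rewrite mxrank0.
by rewrite (leq_trans (mxrank_add _ _)) // leq_add2l.
Qed.

Lemma rank_diag_le (d : 'rV[R]_n) : (\rank (diag_mx d) <= #|row_support d|)%N.
Proof.
rewrite diag_mx_sum_delta (bigID (fun i => d 0 i != 0)) /= [X in (_ + X)%R]big1 ?addr0.
  rewrite (leq_trans (mxrank_sum_le _ _)) // -sum1_card.
  rewrite [leqRHS](eq_bigl (fun i => d 0 i != 0)); last by move=> i; rewrite inE.
  by apply: leq_sum => i _; apply: leq_trans (mxrank_scale _ _) _; rewrite mxrank_delta.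
by move=> i; rewrite negbK => /eqP->; rewrite scale0r.
Qed.

(** The lower bound comes from completing the diagonal to an invertible one with
    ones on its zero entries. *)
Lemma rank_diag (d : 'rV[R]_n) : \rank (diag_mx d) = #|row_support d|.
Proof.
apply/eqP; rewrite eqn_leq rank_diag_le /=.
pose e : 'rV[R]_n := \row_i (d 0 i == 0)%:R.
have de : diag_mx (d + e) \in unitmx.
  rewrite unitmxE det_diag unitfE; apply/prodf_neq0 => i _; rewrite !mxE.
  have [->|d0] := eqVneq (d 0 i) 0; first by rewrite add0r oner_eq0.
  by rewrite addr0.
have := mxrank_unit de; rewrite linearD /= => rk.
have := mxrank_add (diag_mx d) (diag_mx e); rewrite rk.
move=> /leq_trans/(_ (leq_add (leqnn _) (rank_diag_le e))).
rewrite -[X in (X <= _)%N](card_ord n) -(cardsC (row_support d)).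
rewrite (_ : row_support e = ~: row_support d) ?leq_add2r //.
by apply/setP => i; rewrite !inE mxE pnatr_eq0 eqb0 !negbK.
Qed.

Lemma rank_diagonalized S P : diagonalizers S P ->
  \rank (vsval S) = #|row_support (lambda S)|.
Proof.
move=> [PP SE]; have Pu : P \in unitmx by have [] := mulmx1_unit PP.
rewrite {1}SE mxrankMfree ?row_free_unit ?unitmx_tr // -mxrank_tr trmx_mul tr_diag_mx.
by rewrite mxrankMfree ?row_free_unit ?unitmx_tr // rank_diag.
Qed.

Lemma diagonalizer_ge0 X P : diagonalizers X P -> psd X -> forall i, 0 <= lambda X 0 i.
Proof. by move=> [PP XE]; exact: psd_diag PP XE. Qed.

Lemma diagonalizer_le0 S P : diagonalizers S P -> psd (- S) ->
  forall i, lambda S 0 i <= 0.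
Proof.
move=> [PP SE] hS i.
have E : vsval (- S) = P *m diag_mx (- lambda S) *m P^T.
  by rewrite !linearN /= {1}SE mulNmx.
by have := psd_diag PP E hS i; rewrite mxE oppr_ge0.
Qed.

(** Both supports are final segments of the indices, so their sizes compare
    them. *)
Lemma row_support_sub (d e : 'rV[R]_n) :
    (forall i j : 'I_n, (i <= j)%N -> d 0 j <= d 0 i) -> (forall i, d 0 i <= 0) ->
    (forall i j : 'I_n, (i <= j)%N -> e 0 j <= e 0 i) -> (forall i, e 0 i <= 0) ->
    (#|row_support d| <= #|row_support e|)%N ->
  forall i, d 0 i != 0 -> e 0 i != 0.
Proof.
move=> ds d0 es e0 cardle i di; apply: contraTneq cardle => ei; rewrite -ltnNge.
apply/proper_card/properP; split; last first.
  by exists i; rewrite mem_row_support // ei eqxx.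
apply/fintype.subsetP => j; rewrite !mem_row_support => ej.
have ij : (i <= j)%N.
  rewrite leqNgt; apply: contra ej => /ltnW /es.
  by rewrite ei => ej; rewrite eq_le e0.
rewrite lt_eqF // (le_lt_trans (ds _ _ ij)) //.
by rewrite lt_neqAle di d0.
Qed.

Section UnitColumns.
Variable J : {set 'I_n}.
Let EJ : 'M[R]_(n, #|J|) := cols 1%:M J.

Lemma cols1_tr_mul : EJ^T *m EJ = 1%:M.
Proof.
apply/matrixP => a b; rewrite mxE (bigD1 (enum_val a)) //= big1 => [|i ia].
  by rewrite !mxE eqxx mul1r addr0 (inj_eq enum_val_inj).
by rewrite !mxE (negPf ia) mul0r.
Qed.

Lemma cols1_mul_tr : EJ *m EJ^T = diag_mx (\row_i (i \in J)%:R).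
Proof.
apply/matrixP => a b; rewrite !mxE.
under eq_bigr do rewrite !mxE.
rewrite -(big_enum_val (fun i => (a == i)%:R * (b == i)%:R)) /=.
have [aJ|aJ] := boolP (a \in J).
  rewrite (bigD1 a) //= eqxx mul1r big1 ?addr0 => [|i /andP[_ /negPf ia]].
    by rewrite eq_sym.
  by rewrite eq_sym ia mul0r.
rewrite big1 ?mul0rn // => i iJ; case: eqVneq => [ai|]; last by rewrite mul0r.
by rewrite ai iJ in aJ.
Qed.

End UnitColumns.

Lemma lambda_deigvals X i : lambda X 0 i \in deigvals X.
Proof.
rewrite mxE /deigvals; set s := undup _.
(* [0] is also the default value returned beyond the end of [eigvals X] *)
have z : 0 \in (if 0 \in s then s else rcons s 0).
  by case: ifP => // _; rewrite mem_rcons inE eqxx.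
have [lt|ge] := ltnP i (size (eigvals X)); last by rewrite nth_default.
have m : (eigvals X)`_i \in s by rewrite mem_undup mem_nth.
by case: ifP => _ //; rewrite mem_rcons inE m orbT.
Qed.

Lemma deigvals_uniq X : uniq (deigvals X).
Proof.
rewrite /deigvals; case: ifP => [_|h]; first exact: undup_uniq.
by rewrite rcons_uniq undup_uniq h.
Qed.

Section BlockDiagonal.
Variables (X : symmx R n) (Q : 'M[R]_n).
Hypothesis QX : forall a b, lambda X 0 a != lambda X 0 b -> Q a b = 0.

Let Qs j : 'M[R]_#|alpha_class X j| :=
  (cols 1%:M (alpha_class X j))^T *m Q *m cols 1%:M (alpha_class X j).

(** Commuting with [diag_mx (lambda X)] means vanishing off the diagonal blocks
    given by the eigenvalue classes, each index lying in exactly one class. *)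
Lemma BlkDiag_blocks : BlkDiag Qs = Q.
Proof.
have jP a : (index (lambda X 0%R a) (deigvals X) < size (deigvals X))%N.
  by rewrite index_mem lambda_deigvals.
pose j0 a := Ordinal (jP a).
have inJ a j : (a \in alpha_class X j) = (j == j0 a).
  rewrite inE; apply/eqP/eqP => [E|->]; last by rewrite nth_index ?lambda_deigvals.
  by apply/val_inj; rewrite /= E index_uniq ?deigvals_uniq.
apply/matrixP => a b; rewrite /BlkDiag summxE (bigD1 (j0 a)) //=.
have E j : (cols 1%:M (alpha_class X j) *m Qs j *m (cols 1%:M (alpha_class X j))^T) a b
    = (a \in alpha_class X j)%:R * Q a b * (b \in alpha_class X j)%:R.
  rewrite /Qs !mulmxA cols1_mul_tr -mulmxA cols1_mul_tr.
  by rewrite mul_mx_diag mul_diag_mx !mxE.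
rewrite big1 => [|j ja]; last by rewrite E inJ (negPf ja) !mul0r.
rewrite addr0 E !inJ eqxx mul1r.
have [ab|/QX->] := eqVneq (lambda X 0 a) (lambda X 0 b); last by rewrite mul0r.
by rewrite (_ : j0 a == j0 b) ?mulr1 //; apply/eqP/val_inj; rewrite /= ab.
Qed.

(** The projection onto the coordinates of a class commutes with [Q], so
    compressing to a class preserves orthogonality. *)
Lemma orthmx_blocks j : orthmx Q -> orthmx (Qs j).
Proof.
rewrite /orthmx => QQ; rewrite /Qs; set EJ : 'M[R]_(n, #|alpha_class X j|) := cols _ _.
have C : EJ *m EJ^T *m Q = Q *m (EJ *m EJ^T).
  rewrite cols1_mul_tr; apply/matrixP => a b; rewrite mul_mx_diag mul_diag_mx !mxE !inE.
  have [->|/QX->] := eqVneq (lambda X 0 a) (lambda X 0 b); last by rewrite mulr0 mul0r.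
  by rewrite mulrC.
have -> : (EJ^T *m Q *m EJ)^T *m (EJ^T *m Q *m EJ) =
    EJ^T *m Q^T *m (EJ *m EJ^T *m Q) *m EJ by rewrite !trmx_mul trmxK !mulmxA.
rewrite C !mulmxA -(mulmxA EJ^T Q^T Q) QQ mulmx1 cols1_tr_mul mul1mx.
exact: cols1_tr_mul.
Qed.

End BlockDiagonal.

Lemma diagonalizers_commute X P P' : diagonalizers X P -> diagonalizers X P' ->
  forall a b, lambda X 0 a != lambda X 0 b -> (P^T *m P') a b = 0.
Proof.
move=> [PP XE] [PP' XE'] a b ab.
have : diag_mx (lambda X) *m (P^T *m P') = P^T *m P' *m diag_mx (lambda X).
  have L : P^T *m vsval X *m P' = diag_mx (lambda X) *m (P^T *m P').
    by rewrite XE !mulmxA PP mul1mx.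
  have L' : P^T *m vsval X *m P' = P^T *m P' *m diag_mx (lambda X).
    by rewrite XE' -!mulmxA PP' mulmx1.
  by rewrite -L -L'.
move: (lambda X) ab (P^T *m P') => l lab M /(congr1 (fun M : 'M_n => M a b)).
rewrite mul_mx_diag mul_diag_mx !mxE mulrC => /eqP.
by rewrite -subr_eq0 -mulrBr mulf_eq0 orbC subr_eq0 (negPf lab) /= => /eqP.
Qed.

Section Sets.
Variables (E : vectType R) (calB : {linear E -> symmx R n}).

(** Since the columns indexed by gamma span the range of [S], the condition does
    not depend on the diagonalizer. *)
Lemma mem_Upsilon_tilde X S w : normal_cone frob psd X S ->
  Upsilon_tilde calB X S w <-> vsval (calB w) *m vsval S = 0.
Proof.
move=> NS; have [hX hS _] := (normal_cone_psd X S).1 NS.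
split=> [[P [dX dS]]|h].
  have [PP SE] := dS.
  rewrite (annihilatesP _ (diagonalizer_ge0 dX hX) (diagonalizer_le0 dS hS)) //.
  by move=> /(diag_kernelP _ _ PP); rewrite -SE.
have [P [dX dS]] := simultaneous_diagonalizer NS; exists P; split => //.
have [PP SE] := dS.
rewrite (annihilatesP _ (diagonalizer_ge0 dX hX) (diagonalizer_le0 dS hS)) //.
by apply/(diag_kernelP _ _ PP); rewrite -SE.
Qed.

(** The matrix [R] of Upsilon is a common diagonalizer [P'] of [X] and [S']: it
    differs from a common diagonalizer [P] of [X] and [S] by [P^T *m P'], which is
    block diagonal because both diagonalize [X]; by the rank inequality its columns
    indexed by the gamma of [S] are among those spanning the range of [S']. *)
Lemma kernel_sub_Upsilon X S S' w :
    normal_cone frob psd X S -> normal_cone frob psd X S' ->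
    (\rank (vsval S) <= \rank (vsval S'))%N ->
  vsval (calB w) *m vsval S' = 0 -> Upsilon calB X S w.
Proof.
move=> NS NS' rk h; have [hX hS _] := (normal_cone_psd X S).1 NS.
have [_ hS' _] := (normal_cone_psd X S').1 NS'.
have [P [dX dS]] := simultaneous_diagonalizer NS.
have [P' [dX' dS']] := simultaneous_diagonalizer NS'.
have [PP _] := dS; have [PP' SE'] := dS'.
have QX := diagonalizers_commute dX dX'.
have PQ : P *m (P^T *m P') = P' by rewrite mulmxA (mulmx1C PP) mul1mx.
exists P; exists (fun j => (cols 1%:M (alpha_class X j))^T *m (P^T *m P') *m
  cols 1%:M (alpha_class X j)); split => //.
- move=> j; apply: orthmx_blocks => //; rewrite /orthmx trmx_mul trmxK.
  by rewrite mulmxA -(mulmxA _ P) (mulmx1C PP) mulmx1.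
- by rewrite BlkDiag_blocks // PQ.
rewrite BlkDiag_blocks // PQ.
rewrite (annihilatesP _ (diagonalizer_ge0 dX hX) (diagonalizer_le0 dS hS)) // => i Si.
apply: (diag_kernelP (lambda S') (vsval (calB w)) PP').1; first by rewrite -SE'.
have cardle : (#|row_support (lambda S)| <= #|row_support (lambda S')|)%N.
  by move: rk; rewrite (rank_diagonalized dS) (rank_diagonalized dS').
have S0 := diagonalizer_le0 dS hS; have S'0 := diagonalizer_le0 dS' hS'.
exact: (row_support_sub (@lambda_sorted _ _ S) S0 (@lambda_sorted _ _ S') S'0 cardle Si).
Qed.

End Sets.

End Upsilons.

(** * Multipliers under a Slater condition *)

Section Compactness.
Variables (R : realType) (n : nat).
Implicit Types (T : symmx R n).

Lemma psd_wbounded (Ts : nat -> symmx R n) C : (forall k, psd (Ts k)) ->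
  (forall k, \tr (vsval (Ts k)) <= C) -> wbounded frob Ts.
Proof.
move=> hT hC; apply: (@enorm_wbounded _ _ _ _ 0 C) => k.
rewrite subr0 (le_trans _ (hC k)) // enorm_le ?psd_tr_ge0 //.
exact: frob_le_tr.
Qed.

Lemma wlim_psd (Ts : nat -> symmx R n) T : (forall k, psd (Ts k)) ->
  wlim frob Ts T -> psd T.
Proof.
move=> hT lT; apply: psd_dual => Y hY; rewrite (dotC frob).
have h k : 0 <= frob Y (Ts k) by exact: frob_psd_ge0.
exact: (ulim_le (@ulim_cst _ 0) (lT Y) h).
Qed.

Lemma wlim_linear (U V : vectType R) (dotU : {dot U for idfun})
    (dotV : {dot V for idfun}) (A : {linear U -> V}) (xs : nat -> U) x :
  wlim dotU xs x -> wlim dotV (fun k => A (xs k)) (A x).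
Proof.
move=> hx h; rewrite -(adjointP dotU); under eq_fun do rewrite -(adjointP dotU).
exact: hx.
Qed.

End Compactness.

Arguments wlim_linear {R U V dotU} dotV A {xs x}.

Section Multipliers.
Variables (R : realType) (E : vectType R) (dot : {dot E for idfun}) (n : nat).
Variables (calB : {linear E -> symmx R n}) (B : symmx R n).
Implicit Types (x u c : E) (T Y : symmx R n).

Definition slater x (e : R) : Prop := psd (calB x - B - e *: symmat 1%:M).

(** Regularity at [(x, 0)] with the right-hand side [e *: 1]: the residual at [x]
    is finite, hence so is the distance to the solution set, which is therefore
    nonempty. *)
Lemma metrically_regular_slater x :
  metrically_regular dot frob (constraint_map calB B) x 0 ->
  exists xh (e : R), 0 < e /\ slater xh e.
Proof.
move=> [[Y0 hY0 E0] [delta [kappa [delta0 kappa0 h]]]].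
pose I := symmat (1%:M : 'M[R]_n); pose c := enorm frob I.
have c0 : 0 <= c by exact: enorm_ge0.
pose e := delta / (c + 1).
have e0 : 0 < e by rewrite divr_gt0 // ltr_wpDl.
have := h x (e *: I).
rewrite subrr enorm0 expr0n /= add0r subr0 enormZ gtr0_norm // -/c.
have ec : e * c <= delta.
  by rewrite /e -mulrA ger_pMr // ler_pdivrMl ?ltr_wpDl // mulr1 lerDl.
have ec2 : (e * c) ^+ 2 <= delta ^+ 2.
  by rewrite ler_sqr // nnegrE; [exact: mulr_ge0 (ltW e0) c0|exact: ltW].
move=> /(_ ec2) {}h.
have [u [Y hY uY]] : [set u | constraint_map calB B u (e *: I)] !=set0.
  apply/set0P/eqP => S0; move: h; rewrite S0 /set_dist image_set0 ereal_inf0 leye_eq.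
  have le1 : (set_dist frob (e *: I) (constraint_map calB B x) <= (enorm frob (e *: I))%:E)%E.
    apply: ereal_inf_lbound; exists 0; first by exists Y0.
    by rewrite subr0.
  have le2 : (kappa%:E * set_dist frob (e *: I) (constraint_map calB B x) <=
      kappa%:E * (enorm frob (e *: I))%:E)%E by rewrite lee_pmul2l // lte_fin.
  by move=> /eqP F; move: le2; rewrite /set_dist F leye_eq.
exists u, e; split => //; rewrite /slater -/I -uY.
by rewrite opprB addrC subrK.
Qed.

Lemma frob_identity T : frob T (symmat 1%:M) = \tr (vsval T).
Proof. by rewrite /frob symmatK ?trmx1 // mulmx1. Qed.

Lemma slater_trace_le xh e T : slater xh e -> psd T ->
  e * \tr (vsval T) <= frob T (calB xh - B).
Proof.
move=> sl hT; have := frob_psd_ge0 hT sl.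
by rewrite (dotBr frob) (dotZr frob) /= frob_identity subr_ge0.
Qed.

(** Project [(c, 0)] onto the cone of the pairs
    [(adjoint T, frob T (calB u - B))] with [T] psd; the trace bound at the Slater
    point makes a minimizing sequence bounded.  The residual [(r, - s)] of the
    projection satisfies [s *: (calB u - B) - calB r] psd, so moving from [u] along
    [- r] stays feasible and minimality of [u] gives [dot c r <= 0]; but
    [dot c r = dot r r + s * s], so the residual is zero. *)
Lemma multiplier_exists xh e u c : 0 < e -> slater xh e ->
    feasible calB B u -> (forall x, feasible calB B x -> dot c u <= dot c x) ->
  exists T, [/\ psd T, frob T (calB u - B) = 0 & forall x, dot c x = frob T (calB x)].
Proof.
move=> e0 sl uF umin; set G := calB u - B.
pose A T := adjoint dot frob calB T.
have AP T x : dot (A T) x = frob T (calB x) by exact: adjointP.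
pose q T := dot (A T - c) (A T - c) + frob T G ^+ 2.
have q_ge0 T : psd T -> 0 <= q T by move=> _; rewrite addr_ge0 ?sqr_ge0 // dot_ge0.
have [m [Ts [hT qT m_le]]] := minimizing_sequence (ex_intro _ 0 (@psd0 R n)) q_ge0.
pose C := m + 1.
have qC k : q (Ts k) <= C.
  by rewrite (le_trans (qT k)) // lerD2l invf_le1 ?ltr0n // ler1n.
have C0 : 0 <= C by exact: le_trans (q_ge0 _ (hT 0)) (qC 0).
have trT k : \tr (vsval (Ts k)) <=
    e^-1 * (Num.sqrt C + (Num.sqrt C * enorm dot (xh - u) + dot c (xh - u))).
  rewrite ler_pdivlMl // (le_trans (slater_trace_le sl (hT k))) //.
  have -> : calB xh - B = G + calB (xh - u).
    by rewrite linearB /G [RHS]addrC addrA subrK.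
  rewrite (dotDr frob) /= -AP; apply: lerD.
    rewrite (le_trans (ler_norm _)) // -sqrtr_sqr ler_wsqrtr // (le_trans _ (qC k)) //.
    by rewrite lerDr dot_ge0.
  rewrite -lerBlDr -dotBl (le_trans (ler_norm _)) // (le_trans (cauchy_schwarz _ _ _)) //.
  rewrite ler_wpM2r ?enorm_ge0 // ler_wsqrtr // (le_trans _ (qC k)) //.
  by rewrite lerDl sqr_ge0.
have [T lT] := wbounded_wlim (psd_wbounded hT trT).
have psdT := wlim_psd hT lT.
have lA : wlim dot (fun k => A (Ts k) - c) (A T - c).
  apply: wlimB; last exact: wlim_cst.
  move=> h; rewrite dotC AP (dotC frob); under eq_fun do rewrite dotC AP (dotC frob).
  exact: lT.
have lG : (fun k => frob (Ts k) G) @ ufilter --> frob T G.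
  by rewrite (dotC frob); under eq_fun do rewrite (dotC frob); exact: lT.
have qTm T' : psd T' -> q T <= q T'.
  move=> /m_le; apply: le_trans; rewrite -[m]addr0.
  have L1 : (fun k => q (Ts k)) @ ufilter --> q T.
    by apply: cvgD; [exact: wlim_dot|rewrite expr2; under eq_fun do rewrite expr2; exact: cvgM].
  have L2 : (fun k => m + k.+1%:R^-1) @ ufilter --> m + 0.
    by apply: cvgD; [exact: ulim_cst|exact: ulim_harmonic].
  exact: (ulim_le L1 L2 qT).
set s := frob T G; set r := c - A T.
have rX : r = - (A T - c) by rewrite opprB.
have qD (t : R) T' : q (T + t *: T') = q T + (t * (s * frob T' G - frob T' (calB r)) *+ 2
    + t ^+ 2 * (dot (A T') (A T') + frob T' G ^+ 2)).
  have AE : A (T + t *: T') = A T + t *: A T'.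
    apply: (@dot_inj _ _ dot) => z; rewrite AP dotDl dotZl !AP.
    by rewrite (dotDl frob) (dotZl frob).
  rewrite /q AE (dotDl frob) (dotZl frob) /= -/s -AP rX addrAC.
  move: (A T - c) => X; rewrite !(dotDl, dotDr, dotZl, dotZr) dotNr (dotC dot X (A T')).
  ring.
have var T' : psd T' -> frob T' (calB r) <= s * frob T' G.
  move=> hT'; rewrite -subr_ge0; set a := _ - _.
  pose b := dot (A T') (A T') + frob T' G ^+ 2.
  have b0 : 0 <= b by rewrite addr_ge0 ?sqr_ge0 ?dot_ge0.
  have H t : 0 < t -> 0 <= a *+ 2 + t * b.
    move=> t0; have := qTm _ (psdD psdT (psdZ (ltW t0) hT')).
    rewrite qD -/a -/b lerDl => h; rewrite -(pmulr_rge0 _ t0).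
    by apply: le_trans h _; rewrite le_eqVlt; apply/orP; left; apply/eqP; ring.
  (* the first-order term [a *+ 2] dominates [t * b] for [t] as below, [b] being nonnegative *)
  rewrite leNgt; apply/negP => a0.
  have := H (- a / (b + 1)); rewrite divr_gt0 ?oppr_gt0 ?ltr_wpDl // => /(_ isT).
  apply/negP; rewrite -ltNge.
  have -> : a *+ 2 + - a / (b + 1) * b = a * ((b + 2) / (b + 1)).
    by field; rewrite lt0r_neq0 // ltr_wpDl.
  by rewrite nmulr_rlt0 // divr_gt0 // ltr_wpDl.
have varT : frob T (calB r) = s * s.
  apply/eqP; rewrite eq_le var //=.
  have H t : 0 < t -> t < 1 -> (s * s - frob T (calB r)) *+ 2 <=
      t * (dot (A T) (A T) + frob T G ^+ 2).
    move=> t0 t1.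
    have h1 : psd (T + (- t) *: T).
      by rewrite -{1}[T]scale1r -scalerDl; apply: psdZ => //; rewrite subr_ge0 ltW.
    have := qTm _ h1; rewrite qD -/s lerDl => h; rewrite -(ler_pM2l t0).
    rewrite -subr_ge0; apply: le_trans h _.
    by rewrite le_eqVlt; apply/orP; left; apply/eqP; ring.
  rewrite -subr_ge0 leNgt -oppr_gt0 opprB; apply/negP => a0.
  set a := _ - _ in H a0; set b := dot _ _ + _ in H.
  have b0 : 0 <= b by rewrite addr_ge0 ?sqr_ge0 ?dot_ge0.
  have ab : 0 < a + b + 1 by rewrite ltr_wpDl // addr_ge0 // ltW.
  have := H (a / (a + b + 1)).
  rewrite divr_gt0 // ltr_pdivrMr // mul1r -addrA ltrDl ltr_wpDl // => /(_ isT isT).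
  apply/negP; rewrite -ltNge addrA mulrAC ltr_pdivrMr //.
  have h1 : 0 <= a * b by rewrite mulr_ge0 // ltW.
  have h2 : 0 <= a * a by rewrite mulr_ge0 // ltW.
  have -> : a *+ 2 * (a + b + 1) = a * b + (a * a *+ 2 + a * b + a *+ 2) by ring.
  rewrite ltrDl ltr_wpDl //; first by rewrite addr_ge0 // mulrn_wge0.
  by rewrite mulr2n addr_gt0.
have rr : dot c r = dot r r + s * s.
  by rewrite -varT -AP -dotDl /r subrK.
have s0 : 0 <= s by exact: frob_psd_ge0.
have psdM : psd (s *: G - calB r).
  apply: psd_dual => Y hY; rewrite (dotC frob) (dotBr frob) (dotZr frob) /=.
  by rewrite subr_ge0 var.
have cr (t : R) : 0 <= t -> psd (G - t *: calB r) -> 0 < t -> dot c r <= 0.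
  move=> _ h t0.
  have /umin : feasible calB B (u - t *: r).
    by rewrite /feasible /= linearB linearZ /= addrAC -/G.
  by rewrite dotBr dotZr lerBrDr gerDl pmulr_rle0.
have cr0 : dot c r <= 0.
  have [s00|s_neq0] := eqVneq s 0.
    apply: (cr 1) => //; rewrite scale1r; apply: psdD => //.
    by move: psdM; rewrite s00 scale0r sub0r.
  have s_gt0 : 0 < s by rewrite lt_def s_neq0.
  apply: (cr s^-1); rewrite ?invr_ge0 ?invr_gt0 //.
  have -> : G - s^-1 *: calB r = s^-1 *: (s *: G - calB r).
    by rewrite scalerBr scalerA mulVf // scale1r.
  by apply: psdZ; rewrite ?invr_ge0.
have [r0 s00] : r = 0 /\ s = 0.
  move: cr0; rewrite rr => h.
  have h1 := dot_ge0 dot r; have h2 : 0 <= s * s by rewrite -expr2 sqr_ge0.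
  split; apply/eqP; first by rewrite -(dot_eq0 dot) eq_le h1 andbT; lra.
  rewrite -[_ == 0]orbb -mulf_eq0 eq_le h2 andbT; lra.
exists T; split => // x; rewrite -AP; congr (dot _ x).
by apply/eqP; rewrite -subr_eq0; apply/eqP.
Qed.

End Multipliers.

(** * Uniform quadratic growth *)

Section Growth.
Variables (R : realType) (E : vectType R) (dot : {dot E for idfun}) (n : nat).
Variables (calB : {linear E -> symmx R n}) (B : symmx R n) (d xs : E).
Implicit Types (x u c w : E) (T Y : symmx R n).

Definition multiplier_of c u T :=
  [/\ psd T, frob T (calB u - B) = 0 & forall x, dot c x = frob T (calB x)].

Lemma wlim_mulmx (As Ts : nat -> symmx R n) (A T : symmx R n) :
  wlim frob As A -> wlim frob Ts T ->
  wlim (@mxdot R n n) (fun k => vsval (As k) *m vsval (Ts k)) (vsval A *m vsval T).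
Proof.
move=> lA lT h /=; rewrite mxdot_mulr; under eq_fun do rewrite mxdot_mulr.
have lA' : wlim (@mxdot R n n) (fun k => vsval (As k)) (vsval A).
  exact: (wlim_linear _ (@vsval R _ (symsp R n)) lA).
have lT' : wlim (@mxdot R n n) (fun k => vsval (Ts k)) (vsval T).
  exact: (wlim_linear _ (@vsval R _ (symsp R n)) lT).
apply: (wlim_dot _ lT') => g; rewrite symmx_tr; under eq_fun do rewrite symmx_tr.
exact: (wlim_linear (@mxdot R n n) (mulmxr h) lA').
Qed.

(** Pairing with the Slater point bounds the trace, and so the norm, of all
    multipliers near the solution at once. *)
Lemma tilted_multiplier_bound xh e u c T : 0 < e -> slater calB B xh e ->
    enorm dot (u - xs) <= 1 -> enorm dot (c - d) <= 1 -> multiplier_of c u T ->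
  \tr (vsval T) <=
    e^-1 * (enorm dot (xh - xs) + 1 + enorm dot d * enorm dot (xh - xs) + enorm dot d).
Proof.
move=> e0 sl u1 c1 [hT TG cT]; rewrite ler_pdivlMl // (le_trans (slater_trace_le sl hT)) //.
have -> : frob T (calB xh - B) = dot c (xh - u).
  rewrite cT linearB -[LHS]subr0 -TG -(dotBr frob) /=; congr (frob T _).
  by rewrite opprB addrA subrK.
have -> : dot c (xh - u) = dot (c - d) (xh - xs) + dot (c - d) (xs - u)
    + dot d (xh - xs) + dot d (xs - u).
  by rewrite !(dotBl, dotBr); ring.
have CS a b : dot a b <= enorm dot a * enorm dot b.
  exact: le_trans (ler_norm _) (cauchy_schwarz _ _ _).
have u1' : enorm dot (xs - u) <= 1 by rewrite enormB.
rewrite !lerD ?CS //.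
- by rewrite (le_trans (CS _ _)) // ler_piMl ?enorm_ge0.
- by rewrite (le_trans (CS _ _)) // mulr_ile1 ?enorm_ge0.
by rewrite (le_trans (CS _ _)) // ler_piMr ?enorm_ge0.
Qed.

Lemma feasible_trace_bound x : enorm dot (x - xs) <= 1 ->
  \tr (vsval (calB x - B)) <= frob (symmat 1%:M) (calB xs - B)
    + enorm dot (adjoint dot frob calB (symmat 1%:M)).
Proof.
move=> x1; rewrite -frob_identity (dotC frob).
have -> : calB x - B = calB xs - B + calB (x - xs).
  by rewrite linearB [RHS]addrC addrA subrK.
rewrite (dotDr frob) lerD2l /= -(adjointP dot) (le_trans (ler_norm _)) //.
by rewrite (le_trans (cauchy_schwarz _ _ _)) // ler_piMr ?enorm_ge0.
Qed.

Hypothesis critical : forall T, multiplier_of d xs T ->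
  forall w, vsval (calB w) *m vsval T = 0 -> w = 0.

(** By compactness: from steps violating the bound with constants tending to zero,
    the normalized steps converge to a unit vector [w] and the multipliers to some
    [T] with [calB w *m T = 0]. *)
Lemma uniform_quadratic_growth xh e : 0 < e -> slater calB B xh e ->
  exists2 kappa, 0 < kappa & forall u x c T,
    feasible calB B u -> feasible calB B x ->
    enorm dot (u - xs) <= kappa -> enorm dot (x - xs) <= kappa ->
    enorm dot (c - d) <= kappa -> multiplier_of c u T ->
    kappa * dot (x - u) (x - u) <= dot c (x - u).
Proof.
move=> e0 sl; apply: contrapT => nogrowth.
(* a violation [((u, x), (c, T))] of the bound with constant [kappa] *)
pose bad kappa (p : (E * E) * (E * symmx R n)) :=
  [/\ feasible calB B p.1.1 /\ feasible calB B p.1.2,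
      enorm dot (p.1.1 - xs) <= kappa /\ enorm dot (p.1.2 - xs) <= kappa,
      enorm dot (p.2.1 - d) <= kappa, multiplier_of p.2.1 p.1.1 p.2.2 &
      dot p.2.1 (p.1.2 - p.1.1) < kappa * dot (p.1.2 - p.1.1) (p.1.2 - p.1.1)].
have bad_ex (k : nat) : exists p, bad k.+1%:R^-1 p.
  apply: contrapT => nobad; apply: nogrowth; exists k.+1%:R^-1; first by rewrite invr_gt0.
  move=> u x c T uF xF u1 x1 c1 cT; rewrite leNgt; apply/negP => h.
  by apply: nobad; exists ((u, x), (c, T)); exact: And5 (conj uF xF) (conj u1 x1) c1 cT h.
have [p pP] := choice bad_ex.
pose us k := (p k).1.1; pose ys k := (p k).1.2; pose cs k := (p k).2.1; pose Ts k := (p k).2.2.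
pose h k : R := k.+1%:R^-1.
have uF k : feasible calB B (us k) by have [[F _] _ _ _ _] := pP k; exact: F.
have yF k : feasible calB B (ys k) by have [[_ F] _ _ _ _] := pP k; exact: F.
have u_near k : enorm dot (us k - xs) <= h k by have [_ []] := pP k.
have y_near k : enorm dot (ys k - xs) <= h k by have [_ []] := pP k.
have c_near k : enorm dot (cs k - d) <= h k by have [] := pP k.
have cT k : multiplier_of (cs k) (us k) (Ts k) by have [] := pP k.
have viol k : dot (cs k) (ys k - us k) < h k * dot (ys k - us k) (ys k - us k).
  by have [] := pP k.
have h1 k : h k <= 1 by rewrite invf_le1 ?ltr0n // ler1n.
have h0 k : 0 <= h k by rewrite invr_ge0.
have lh : h @ ufilter --> (0 : R) by exact: ulim_harmonic.
have lu : wlim dot us xs := enorm_wlim u_near lh.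
have lc : wlim dot cs d := enorm_wlim c_near lh.
pose CT := e^-1 * (enorm dot (xh - xs) + 1 + enorm dot d * enorm dot (xh - xs) + enorm dot d).
have trT k : \tr (vsval (Ts k)) <= CT.
  apply: (tilted_multiplier_bound e0 sl _ _ (cT k)).
    exact: le_trans (u_near k) (h1 k).
  exact: le_trans (c_near k) (h1 k).
have psdTs k : psd (Ts k) by have [] := cT k.
have [T lT] := wbounded_wlim (psd_wbounded psdTs trT).
have psdT := wlim_psd psdTs lT.
have lG : wlim frob (fun k => calB (us k) - B) (calB xs - B).
  apply: wlimB; last exact: wlim_cst.
  exact: (wlim_linear frob calB lu).
have TG : frob T (calB xs - B) = 0.
  apply: (ulim_unique (wlim_dot lT lG)) => /=.
  have -> : (fun k => frob (Ts k) (calB (us k) - B)) = fun=> 0.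
    by apply/funext => k; have [] := cT k.
  exact: ulim_cst.
have dT x : dot d x = frob T (calB x).
  rewrite dotC (dotC frob); apply: (ulim_unique (lc x)).
  have -> : (fun k => dot x (cs k)) = fun k => frob (calB x) (Ts k).
    by apply/funext => k; have [_ _ H] := cT k; rewrite dotC H (dotC frob).
  exact: lT.
pose t k := enorm dot (ys k - us k).
have tt k : dot (ys k - us k) (ys k - us k) = t k ^+ 2 by rewrite sqr_enorm.
have t_gt0 k : 0 < t k.
  rewrite lt_def enorm_ge0 andbT enorm_eq0; apply: contraTneq (viol k) => ->.
  by rewrite !dot0r mulr0 ltxx.
pose ws k := (t k)^-1 *: (ys k - us k).
have ww k : dot (ws k) (ws k) = 1.
  by rewrite dotZl dotZr tt mulrA -expr2 -exprMn mulVf ?expr1n // gt_eqF.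
have [w lw] : exists w, wlim dot ws w.
  apply/wbounded_wlim/(@enorm_wbounded _ _ _ _ 0 1) => k.
  by rewrite subr0 /enorm ww sqrtr1.
have w1 : dot w w = 1.
  apply: (ulim_unique (wlim_dot lw lw)).
  by under eq_fun do rewrite ww; exact: ulim_cst.
have lBw : wlim frob (fun k => calB (ws k)) (calB w) by exact: (wlim_linear frob calB lw).
have lM := wlim_mulmx lBw lT.
pose CY := frob (symmat 1%:M) (calB xs - B)
    + enorm dot (adjoint dot frob calB (symmat 1%:M)).
have trY k : \tr (vsval (calB (ys k) - B)) <= CY.
  apply: feasible_trace_bound; exact: le_trans (y_near k) (h1 k).
pose M k := vsval (calB (ws k)) *m vsval (Ts k).
have ME k : M k = (t k)^-1 *: (vsval (calB (ys k) - B) *m vsval (Ts k)).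
  have [_ XT _] := cT k.
  have X0 : vsval (calB (us k) - B) *m vsval (Ts k) = 0.
    by apply: psd_mul_eq0 => //; [exact: uF|rewrite (dotC frob)].
  rewrite /M /ws linearZ linearZ /= -scalemxAl; congr (_ *: _).
  have -> : calB (ys k - us k) = (calB (ys k) - B) - (calB (us k) - B).
    by rewrite linearB opprB addrA subrK.
  by rewrite linearB mulmxBl X0 subr0.
have Mle k : mxdot (M k) (M k) <= CY * CT * h k.
  rewrite ME (dotZl mxdot) (dotZr mxdot) mulrA -expr2 exprVn ler_pdivrMl ?exprn_gt0 //.
  have Yp := yF k; have Tp := psdTs k.
  apply: le_trans (psd_mul_le Yp Tp) _.
  have YT : frob (calB (ys k) - B) (Ts k) <= h k * t k ^+ 2.
    rewrite -tt; apply: le_trans (ltW (viol k)).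
    have [_ XT H] := cT k; rewrite H linearB (dotC frob) -[leLHS]subr0 -XT -(dotBr frob).
    by rewrite opprB addrA subrK.
  have -> : t k ^+ 2 * (CY * CT * h k) = CY * (h k * t k ^+ 2) * CT by ring.
  have F0 := frob_psd_ge0 Yp Tp; have Y0 := psd_tr_ge0 Yp; have T0 := psd_tr_ge0 Tp.
  by apply: ler_pM; rewrite ?mulr_ge0 ?trT //; apply: ler_pM; rewrite ?trY.
have M0 : mxdot (vsval (calB w) *m vsval T) (vsval (calB w) *m vsval T) = 0.
  apply: (ulim_unique (wlim_dot lM lM)).
  apply: (@ulim0 _ _ (fun k => CY * CT * h k)) => [k|].
    by rewrite ger0_norm ?Mle //; exact: (dot_ge0 mxdot).
  by rewrite -(mulr0 (CY * CT)); apply: cvgM => //; exact: ulim_cst.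
have w0 : w = 0.
  apply: (critical (And3 psdT TG dT)); apply/eqP.
  by rewrite -(dot_eq0 mxdot) /= M0.
by move: w1; rewrite w0 dot0r => /esym/eqP; rewrite oner_eq0.
Qed.

End Growth.

(** * From growth to tilt stability *)

Section Tilt.
Variables (R : realType) (E : vectType R) (dot : {dot E for idfun}) (n : nat).
Variables (calB : {linear E -> symmx R n}) (B : symmx R n) (d xs : E).
Implicit Types (x y u c v w : E) (T Y : symmx R n).

Lemma sdp_objective_in x : feasible calB B x -> sdp_objective dot calB B d x = (dot d x)%:E.
Proof. by move=> xF; rewrite /sdp_objective /indicator_fun mem_set // adde0. Qed.

Lemma sdp_objective_out x : ~ feasible calB B x -> sdp_objective dot calB B d x = +oo%E.
Proof. by move=> xF; rewrite /sdp_objective /indicator_fun memNset. Qed.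

Definition ball_minimizer (r : R) c x :=
  [/\ eball dot xs r x, feasible calB B x &
      forall y, eball dot xs r y -> feasible calB B y -> dot c x <= dot c y].

Lemma tilted_argminP r v : 0 <= r -> feasible calB B xs -> forall x,
  tilted_argmin dot (sdp_objective dot calB B d) xs r v x <-> ball_minimizer r (d - v) x.
Proof.
move=> r0 xsF x.
pose g y := (sdp_objective dot calB B d y - sdp_objective dot calB B d xs
  - (dot v (y - xs))%:E)%E.
rewrite -[tilted_argmin _ _ _ _ _ x]/(eball dot xs r x /\
  forall y, eball dot xs r y -> (g x <= g y)%E).
have gin y : feasible calB B y -> g y = (dot (d - v) y - dot (d - v) xs)%:E.
  move=> yF; rewrite /g (sdp_objective_in yF) (sdp_objective_in xsF) -!EFinB.
  by congr (_%:E); rewrite !dotBl dotBr; ring.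
have gout y : ~ feasible calB B y -> g y = +oo%E.
  by move=> yF; rewrite /g (sdp_objective_out yF) (sdp_objective_in xsF).
move: g gin gout => g gin gout.
have xs_ball : eball dot xs r xs by rewrite /eball /= subrr enorm0.
split=> [[xb xmin]|[xb xF xmin]].
  have xF : feasible calB B x.
    apply: contrapT => xF; have := xmin xs xs_ball.
    by rewrite (gout x xF) (gin xs xsF) leye_eq.
  split=> // y yb yF; have := xmin y yb.
  by rewrite (gin x xF) (gin y yF) lee_fin lerD2r.
split=> // y yb; have [yF|yF] := pselect (feasible calB B y).
  by rewrite (gin x xF) (gin y yF) lee_fin lerD2r; exact: xmin y yb yF.
by rewrite (gout y yF) leey.
Qed.

Lemma ball_minimizer_exists r c : 0 <= r -> feasible calB B xs ->
  exists x, ball_minimizer r c x.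
Proof.
move=> r0 xsF; pose P x := eball dot xs r x /\ feasible calB B x.
have Pxs : exists x, P x.
  by exists xs; split=> //; rewrite /eball /= subrr enorm0.
have lb x : P x -> dot c xs - enorm dot c * r <= dot c x.
  move=> [xb _]; rewrite lerBlDr -lerBlDl -dotBr -opprB dotNr.
  rewrite (le_trans (ler_norm _)) // normrN (le_trans (cauchy_schwarz _ _ _)) //.
  by rewrite ler_wpM2l ?enorm_ge0.
have [m [ys [yP ym m_le]]] := minimizing_sequence Pxs lb.
have yb k : enorm dot (ys k - xs) <= r by have [] := yP k.
have [x lx] := wbounded_wlim (enorm_wbounded yb).
have lx' : wlim dot (fun k => ys k - xs) (x - xs) by apply: wlimB => //; exact: wlim_cst.
have xb : eball dot xs r x.
  rewrite /eball /= enorm_le //.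
  apply: (ulim_le (wlim_dot lx' lx') (@ulim_cst _ (r ^+ 2))) => k.
  by rewrite -enorm_le.
have xF : feasible calB B x.
  apply: (@wlim_psd _ _ (fun k => calB (ys k) - B)).
    by move=> k; have [_ F] := yP k; exact: F.
  by apply: wlimB; [exact: wlim_linear lx|exact: wlim_cst].
exists x; split => // y yb' yF; apply: le_trans (m_le y (conj yb' yF)).
have L2 : (fun k => m + k.+1%:R^-1) @ ufilter --> m + 0.
  by apply: cvgD; [exact: ulim_cst|exact: ulim_harmonic].
by rewrite -[m]addr0; exact: (ulim_le (lx c) L2 ym).
Qed.

Lemma feasible_segment x y (t : R) : 0 <= t <= 1 -> feasible calB B x -> feasible calB B y ->
  feasible calB B (x + t *: (y - x)).
Proof.
move=> /andP[t0 t1] xF yF; rewrite /feasible /=.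
have -> : calB (x + t *: (y - x)) - B = (1 - t) *: (calB x - B) + t *: (calB y - B).
  rewrite [RHS]addrC scalerBl scale1r addrCA -scalerBr opprB addrA subrK.
  by rewrite linearD linearZ linearB /= addrAC.
have t1' : 0 <= 1 - t by rewrite subr_ge0.
exact: psdD (psdZ t1' xF) (psdZ t0 yF).
Qed.

(** Convexity: any feasible point can be approached from [x] inside the ball. *)
Lemma interior_minimizer r c x : enorm dot (x - xs) < r -> ball_minimizer r c x ->
  forall y, feasible calB B y -> dot c x <= dot c y.
Proof.
move=> xr [_ xF xmin] y yF; pose a := enorm dot (x - xs); pose b := enorm dot (y - x).
have b0 : 0 <= b by exact: enorm_ge0.
have ra : 0 < r - a by rewrite subr_gt0.
(* the step [t] is at most 1 and moves [x] by [t * b <= r - a] *)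
have den : 0 < r - a + b by rewrite ltr_wpDr.
pose t := (r - a) / (r - a + b).
have t0 : 0 < t by rewrite divr_gt0.
have t1 : t <= 1 by rewrite ler_pdivrMr // mul1r lerDl.
have tb : t * b <= r - a.
  by rewrite mulrAC ler_pdivrMr // ler_pM2l // lerDr ltW.
have := xmin (x + t *: (y - x)) _ (feasible_segment _ xF yF).
rewrite (ltW t0) t1 dotDr lerDl dotZr pmulr_rge0 // dotBr subr_ge0; apply => //.
rewrite /eball /= addrAC (le_trans (ler_enormD _ _ _)) //.
by rewrite enormZ gtr0_norm // -lerBrDl.
Qed.

(** Growth at the solution confines minimizers of a slightly tilted problem to the
    interior of the ball, where they are global and have multipliers; growth at
    these minimizers then yields uniqueness and the Lipschitz constant [1 / k]. *)
Lemma tilt_stable_of_critical xh e T0 :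
    0 < e -> slater calB B xh e -> feasible calB B xs ->
    multiplier_of dot calB B d xs T0 ->
    (forall T, multiplier_of dot calB B d xs T ->
       forall w, vsval (calB w) *m vsval T = 0 -> w = 0) ->
  tilt_stable dot (sdp_objective dot calB B d) xs.
Proof.
move=> e0 sl xsF T0m crit.
have [k k0 growth] := uniform_quadratic_growth crit e0 sl.
have kk0 : 0 < k * k by rewrite mulr_gt0.
have xs_k : enorm dot (xs - xs) <= k by rewrite subrr enorm0 ltW.
have dd_k : enorm dot (d - d) <= k by rewrite subrr enorm0 ltW.
(* [k] keeps [d - v] within reach of the growth bound; [k * k / 2] keeps the minimizer,
   at distance at most [|v| / k], off the boundary of the ball *)
pose rho := Num.min k (k * k / 2).
have rho0 : 0 < rho by rewrite lt_min k0 divr_gt0.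
have small v : eball dot 0 rho v -> enorm dot v <= k /\ enorm dot v < k * k.
  rewrite /eball /= subr0 le_min => /andP[vk vkk]; split=> //.
  by rewrite (le_lt_trans vkk) // ltr_pdivrMr // ltr_pMr // ltr1n.
have global v x : eball dot 0 rho v -> ball_minimizer k (d - v) x ->
    forall y, feasible calB B y -> dot (d - v) x <= dot (d - v) y.
  move=> /small[_ vkk] xm; apply: (@interior_minimizer k) => //.
  have [xb xF xmin] := xm.
  have g := growth _ _ _ _ xsF xF xs_k xb dd_k T0m.
  have := xmin xs; rewrite /eball /= => /(_ xs_k xsF).
  rewrite -subr_ge0 -dotBr -(opprB x xs) dotNr oppr_ge0 dotBl subr_le0 => h.
  set q := enorm dot (x - xs) in xb *.
  have q0 : 0 <= q by exact: enorm_ge0.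
  have h2 : k * q ^+ 2 <= enorm dot v * q.
    rewrite sqr_enorm (le_trans g) // (le_trans h) // (le_trans (ler_norm _)) //.
    exact: cauchy_schwarz.
  have [->//|qn0] := eqVneq q 0.
  have q_gt0 : 0 < q by rewrite lt_def qn0.
  rewrite -(ltr_pM2l k0) (le_lt_trans _ vkk) // -(ler_pM2r q_gt0).
  by rewrite -mulrA -expr2.
have local_growth v x : eball dot 0 rho v -> ball_minimizer k (d - v) x ->
    forall y, eball dot xs k y -> feasible calB B y ->
    k * dot (y - x) (y - x) <= dot (d - v) (y - x).
  move=> hv xm y yb yF; have [xb xF _] := xm.
  have [T Tm] := multiplier_exists e0 sl xF (global v x hv xm).
  apply: (growth x y (d - v) T) => //.
  by rewrite addrAC subrr sub0r -sub0r enormB subr0; case: (small v hv).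
have [m mP] := choice (fun v => ball_minimizer_exists (d - v) (ltW k0) xsF).
have uniq_min v x : eball dot 0 rho v -> ball_minimizer k (d - v) x -> x = m v.
  move=> hv xm; have [xb xF xmin] := xm; have [mb mF _] := mP v.
  have g := local_growth v (m v) hv (mP v) x xb xF.
  have h := xmin _ mb mF.
  have : k * dot (x - m v) (x - m v) <= 0.
    by rewrite (le_trans g) // dotBr subr_le0.
  rewrite pmulr_rle0 // => h0; apply/eqP; rewrite -subr_eq0 -(dot_eq0 dot).
  by rewrite eq_le h0 dot_ge0.
have argminE v : eball dot 0 rho v ->
    tilted_argmin dot (sdp_objective dot calB B d) xs k v = [set m v].
  move=> hv; apply/seteqP; split=> x.
    by move=> /(tilted_argminP _ (ltW k0) xsF); exact: uniq_min.
  by move=> ->; apply/(tilted_argminP _ (ltW k0) xsF).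
have ball0 : eball dot 0 rho 0 by rewrite /eball /= subrr enorm0 ltW.
have xsm : xs = m 0.
  apply: uniq_min => //; split=> // y yb yF; rewrite subr0 -subr_ge0 -dotBr.
  have := growth _ _ _ _ xsF yF xs_k yb dd_k T0m; apply: le_trans.
  by rewrite mulr_ge0 ?dot_ge0 // ltW.
split.
- split=> [x|]; last by exists xs; rewrite sdp_objective_in.
  by have [xF|xF] := pselect (feasible calB B x);
    rewrite ?(sdp_objective_in xF) ?(sdp_objective_out xF).
- by rewrite sdp_objective_in.
exists k => //; split; first by rewrite argminE // -xsm.
exists rho, k^-1, m; split => // u v hu hv.
have [ub uF _] := mP u; have [vb vF vmin] := mP v.
have g := local_growth u (m u) hu (mP u) (m v) vb vF.
have h := vmin (m u) ub uF.
rewrite (enormB dot (m u)) (enormB dot u) ler_pdivlMl //.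
set q := enorm dot (m v - m u).
have q0 : 0 <= q by exact: enorm_ge0.
have h2 : k * q ^+ 2 <= enorm dot (v - u) * q.
  rewrite sqr_enorm (le_trans g) // (le_trans _ (cauchy_schwarz _ _ _)) //.
  rewrite (le_trans _ (ler_norm _)) //.
  rewrite -subr_ge0; move: h; rewrite -subr_ge0.
  rewrite !(dotBl, dotBr) => h; apply: le_trans h _.
  by rewrite le_eqVlt; apply/orP; left; apply/eqP; ring.
have [->|qn0] := eqVneq q 0; first by rewrite mulr0 enorm_ge0.
have q_gt0 : 0 < q by rewrite lt_def qn0.
by rewrite -(ler_pM2r q_gt0) -mulrA -expr2.
Qed.

End Tilt.

(** * Consequences of tilt stability *)

Section Necessity.
Variables (R : realType) (E : vectType R) (dot : {dot E for idfun}) (n : nat).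
Variables (calB : {linear E -> symmx R n}) (B : symmx R n) (d xs : E).
Implicit Types (w : E) (S T X : symmx R n).

Lemma multipliers_opp T : optimal_solution dot calB B d xs ->
  multiplier_of dot calB B d xs T -> multipliers dot calB B xs (- d) (- T).
Proof.
move=> [xsF xmin] [hT TX dT]; split.
- split; first exact: xsF.
  move=> y yF; rewrite dotNl oppr_le0 dotBr subr_ge0; exact: xmin y yF.
- apply/normal_cone_psd; split; [exact: xsF|by rewrite opprK|].
  by rewrite (dotNl frob) /= TX oppr0.
apply: (@dot_inj _ _ dot) => z.
by rewrite adjointP (dotNl frob) dotNl dT.
Qed.

Lemma multipliers_dot S : multipliers dot calB B xs (- d) S ->
  forall x, dot d x = - frob S (calB x).
Proof.
by move=> [_ _ SB] x; rewrite -[d]opprK -SB dotNl adjointP.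
Qed.

Lemma multiplier_of_opp S : multipliers dot calB B xs (- d) S ->
  multiplier_of dot calB B d xs (- S).
Proof.
move=> hS; have [_ /normal_cone_psd[_ hS' SX] _] := hS.
split=> [//||x]; first by rewrite (dotNl frob) /= SX oppr0.
by rewrite (multipliers_dot hS) (dotNl frob).
Qed.

Lemma tangent_cone_psd X S : psd X -> psd S -> tangent_cone frob psd X S.
Proof.
move=> hX hS; split=> // eps eps0; exists 1, (X + S); first exact: psdD.
by rewrite ler01 scale1r addrAC subrr add0r subrr enorm0.
Qed.

Lemma Sp_normal_cone_psd S T : psd (- S) -> psd T -> frob T S = 0 ->
  Sp (normal_cone frob psd (- S)) T.
Proof.
move=> hS hT TS; exists 1, 0, (- T); split=> //.
- apply/normal_cone_psd; split=> //; first by rewrite oppr0; exact: psd0.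
  exact: (dot0l frob).
- apply/normal_cone_psd; split=> //; first by rewrite opprK.
  by rewrite (dotNl frob) (dotNr frob) /= TS !oppr0.
by rewrite sub0r opprK scale1r.
Qed.

(** The projection [Pi] onto the kernel of [S] is in the cone, so [Pi = calB a];
    along [a] feasibility and objective are kept, so uniqueness of the solution
    gives [a = 0], and [S] has no zero eigenvalue. *)
Lemma kernel_trivial_of_tilt_stable S :
    optimal_solution dot calB B d xs -> multipliers dot calB B xs (- d) S ->
    let K := tangent_cone frob psd (calB xs - B) `&` Sp (normal_cone frob psd (- S)) in
    K `<=` range calB -> {in calB @^-1` K &, injective calB} ->
    tilt_stable dot (sdp_objective dot calB B d) xs ->
  forall w, vsval (calB w) *m vsval S = 0 -> w = 0.
Proof.
move=> [xsF xmin] hS K Krange Kinj [_ _ [r r0 [argmin0 _]]] w wS.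
have [_ NS _] := hS; have [_ hNS SX] := (normal_cone_psd (calB xs - B) S).1 NS.
have KI T : psd T -> frob T S = 0 -> K T.
  by move=> hT TS; split; [exact: tangent_cone_psd|exact: Sp_normal_cone_psd].
have [P [_ [PP SE0]]] := simultaneous_diagonalizer NS.
have [l SE] : exists l, vsval S = P *m diag_mx l *m P^T by exists (lambda S).
pose k : 'rV[R]_n := \row_i (l 0 i == 0)%:R.
pose Pi := symmat (P *m diag_mx k *m P^T).
have PiE : vsval Pi = P *m diag_mx k *m P^T.
  by rewrite symmatK // !trmx_mul trmxK tr_diag_mx mulmxA.
have Pi_psd : psd Pi by apply: (diag_psd PiE) => i; rewrite mxE ler0n.
have PiS : frob Pi S = 0.
  rewrite /frob PiE SE -!mulmxA (mulmxA P^T) PP mul1mx (mulmxA (diag_mx k)) mulmx_diag.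
  have -> : \row_i (k 0 i * l 0 i) = 0.
    by apply/rowP => i; rewrite !mxE; case: eqVneq => [->|]; rewrite ?mulr0 ?mul0r.
  by rewrite linear0 mul0mx mulmx0 mxtrace0.
have [a _ aPi] := Krange _ (KI _ Pi_psd PiS).
pose c := enorm dot a; have c0 : 0 <= c by exact: enorm_ge0.
pose s := r / (c + 1).
have s0 : 0 < s by rewrite divr_gt0 // ltr_wpDl.
have yF : feasible calB B (xs + s *: a).
  have sPi : psd (s *: Pi) by apply: psdZ => //; exact: ltW.
  by rewrite /feasible /= linearD linearZ /= aPi addrAC; exact: psdD xsF sPi.
have ymin : ball_minimizer dot calB B xs r (d - 0) (xs + s *: a).
  split=> //.
    rewrite /eball /= addrAC subrr add0r enormZ gtr0_norm // -/c /s -mulrA ger_pMr //.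
    by rewrite ler_pdivrMl ?ltr_wpDl // mulr1 lerDl.
  move=> y _ hy; rewrite subr0 dotDr dotZr (multipliers_dot hS a) aPi (dotC frob) /= PiS.
  by rewrite oppr0 mulr0 addr0; exact: xmin y hy.
have : [set xs] (xs + s *: a).
  by rewrite -argmin0; exact: (@tilted_argminP _ _ _ _ _ _ d xs r 0 (ltW r0) xsF _).2 ymin.
move=> /= /eqP; rewrite -subr_eq0 addrAC subrr add0r scaler_eq0 gt_eqF //= => /eqP a0.
have Pi0 : P *m diag_mx k *m P^T = 0 by rewrite -PiE -aPi a0 linear0.
have k0 : diag_mx k = 0.
  have := congr1 (fun M => P^T *m M *m P) Pi0.
  by rewrite !mulmxA PP mul1mx -mulmxA PP mulmx1 mulmx0 mul0mx.
have Bw0 : calB w = 0.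
  have W0 : vsval (calB w) *m (P *m diag_mx (const_mx 1) *m P^T) = 0.
    apply/(diag_kernelP _ _ PP) => i _.
    have W : vsval (calB w) *m (P *m diag_mx l *m P^T) = 0 by rewrite -SE.
    move: W => /(diag_kernelP _ _ PP); apply; apply/negP => li.
    have := congr1 (fun M : 'M_n => M i i) k0; rewrite !mxE eqxx li /=.
    by move/eqP; rewrite oner_eq0.
  by move: W0; rewrite diag_const_mx mulmx1 (mulmx1C PP) mulmx1 => h; exact: val_inj.
have K0 : K 0 by apply: KI; [exact: psd0|exact: (dot0l frob)].
by apply: Kinj; rewrite ?inE /= ?Bw0 ?linear0.
Qed.

End Necessity.

Theorem proposition3p3 (R : realType) (E : vectType R) (dot : {dot E for idfun})
    (n : nat) (d : E) (B : symmx R n) (calB : {linear E -> symmx R n}) (xs : E)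
    (hopt : optimal_solution dot calB B d xs)
    (hreg : metrically_regular dot frob (constraint_map calB B) xs 0)
    (Ss : symmx R n) (hS : multipliers dot calB B xs (- d) Ss) :
  let Xs := calB xs - B in
  let Ks := tangent_cone frob psd Xs `&` Sp (normal_cone frob psd (- Ss)) in
  let d_orth : set E := [set w | w \in orthov dot <[d]>%VS] in
  let tilt := tilt_stable dot (sdp_objective dot calB B d) xs in
  let qualified :=
    [/\ Ks `<=` range calB,
        {in calB @^-1` Ks &, injective calB} &
        [set S | adjoint dot frob calB S = 0]
          `&` Sp (normal_cone frob psd Xs) = [set 0]] in
  (* (i) *)
  ((((forall S, multipliers dot calB B xs (- d) S ->
        (\rank (vsval Ss) <= \rank (vsval S))%N) ->
      d_orth `&` Upsilon calB Xs Ss = [set 0] -> tilt) /\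
    (qualified -> tilt -> d_orth `&` Upsilon_tilde calB Xs Ss = [set 0])) /\
  (* (ii) *)
   ((multipliers dot calB B xs (- d) = [set Ss] ->
      Upsilon_hat calB Xs Ss = [set 0] -> tilt) /\
    (qualified -> tilt -> Upsilon_hat calB Xs Ss = [set 0])))%type.
Proof.
move=> Xs Ks d_orth tilt qualified.
have [xsF _] := hopt; have [_ NS _] := hS.
have [xh [e [e0 sl]]] := metrically_regular_slater hreg.
have sufficient := tilt_stable_of_critical e0 sl xsF (multiplier_of_opp hS).
have necessary : qualified -> tilt -> forall w, Upsilon_tilde calB Xs Ss w -> w = 0.
  move=> [Kr Ki _] ht w /(mem_Upsilon_tilde _ _ NS).
  exact: (kernel_trivial_of_tilt_stable hopt hS Kr Ki ht).
have Upsilon_tilde0 : Upsilon_tilde calB Xs Ss 0.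
  by apply/(mem_Upsilon_tilde _ _ NS); rewrite !linear0 mul0mx.
have mulN (A T : symmx R n) : vsval A *m vsval T = 0 -> vsval A *m vsval (- T) = 0.
  by move=> h; have -> : vsval (- T) = - vsval T by []; rewrite mulmxN h oppr0.
split; split.
- move=> rkmin U0; apply: sufficient => T hT w wT.
  have hT' := multipliers_opp hopt hT; have [_ NT _] := hT'.
  suff : (d_orth `&` Upsilon calB Xs Ss) w by rewrite U0.
  split; last exact: (kernel_sub_Upsilon NS NT (rkmin _ hT') (mulN _ _ wT)).
  rewrite /d_orth /= mem_orthov1; apply/eqP.
  have [_ _ dT] := hT; rewrite -[LHS](dotC dot d w) dT.
  by rewrite /frob mxtrace_mulC wT mxtrace0.
- move=> q t; apply/seteqP; split=> [w [_ wU]|_ ->]; first exact: necessary.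
  by split=> //; rewrite /d_orth /= mem0v.
- move=> M1 U0; apply: sufficient => T hT w wT.
  have hT' := multipliers_opp hopt hT.
  have TS : - T = Ss by have : [set Ss] (- T) by rewrite -M1.
  suff : Upsilon_hat calB Xs Ss w by rewrite U0.
  by apply/(mem_Upsilon_tilde _ _ NS); rewrite -TS; exact: mulN.
- move=> q t; apply/seteqP; split=> [w wU|_ -> //]; exact: necessary.
Qed.
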